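(* Let $D$ be an integral domain and let $R$ be a pseudo-polynomial retract $D$-algebra. Let $\Theta$ be a Jaffard family of $D$. Then there is an exact sequence $$0\longrightarrow\mathrm{Pic}(D,\Theta)\longrightarrow\mathrm{Pic}_u(R,D)\xrightarrow{\ \pi_\Theta\ }\bigoplus_{T\in\Theta}\mathrm{Pic}_u(RT,T)\longrightarrow 0,$$ where the first map is induced by extension of ideals $[I]\mapsto[IR]$ and $\pi_\Theta$ is the extension map $[I]\mapsto([IRT])_{T\in\Theta}$, and $$\mathrm{LPic}_u(R,D)\simeq\bigoplus_{T\in\Theta}\mathrm{LPic}_u(RT,T).$$
   Context: All rings are commutative with unit; $D$ is an integral domain that is not a field, with quotient field $K\neq D$. If $A\subseteq B$ are integral domains, the quotient field of $A$ is viewed inside the quotient field of $B$. A fractional ideal of a domain $B$ is a $B$-submodule $I$ of its quotient field with $bI\subseteq B$ for some nonzero $b\in B$; it is integral if $I\subseteq B$. $\mathrm{Inv}(B)$ is the group of invertible fractional ideals of $B$, $\mathrm{Princ}(B)$ the subgroup of nonzero principal fractional ideals, $\mathrm{Pic}(B)=\mathrm{Inv}(B)/\mathrm{Princ}(B)$, and $[I]$ is the class of $I$. A retract $D$-algebra is a $D$-algebra $R$ that is an integral domain and admits a $D$-algebra homomorphism $\epsilon:R\to D$ (then $D\subseteq R$). For an extension $A\subseteq B$ of integral domains, with $F$ the quotient field of $A$: a fractional ideal $I$ of $B$ is unitary with respect to $A$ if $I\cap F\neq(0)$. $\mathrm{Inv}_u(B,A)$ is the subgroup of $\mathrm{Inv}(B)$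 generated by the invertible ideals that are both integral and unitary with respect to $A$; $\mathrm{Pic}_u(B,A):=\mathrm{Inv}_u(B,A)/(\mathrm{Inv}_u(B,A)\cap\mathrm{Princ}(B))$, a subgroup of $\mathrm{Pic}(B)$. The canonical map $\iota:\mathrm{Pic}(A)\to\mathrm{Pic}(B)$, $[I]\mapsto[IB]$, has image in $\mathrm{Pic}_u(B,A)$, and $\mathrm{LPic}_u(B,A):=\mathrm{Pic}_u(B,A)/\iota(\mathrm{Pic}(A))$. $B$ is pseudo-polynomial over $A$ (a pseudo-polynomial $A$-algebra) if every principal integral ideal of $B$ that is unitary with respect to $A$ is generated by an element of $A$. An overring of $D$ is a ring between $D$ and $K$; it is flat if it is flat as a $D$-module. $RT$ is the subring of the quotient field of $R$ consisting of finite sums $\sum r_it_i$ with $r_i\in R$, $t_i\in T$. A Jaffard family of $D$ is a family $\Theta$ of flat overrings of $D$ with $K\notin\Theta$ that is complete ($I=\bigcap_{T\in\Theta}IT$ for every ideal $I$ of $D$), independent ($TT'=K$ for all $T\neq T'$ in $\Theta$) and locally finite (every nonzero $x\in D$ is a non-unit in only finitely many $T\in\Theta$). $\mathrm{Pic}(D,\Theta)$ is the subgroup of $\mathrm{Pic}(D)$ of classes $[I]$ such that $IT$ is principal for every $T\in\Theta$. *)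

(* Defs.v *)
From HB Require Import structures.
From mathcomp Require Import all_boot all_algebra.
From mathcomp Require Import boolp classical_sets functions cardinality.

Set Implicit Arguments.
Unset Strict Implicit.
Unset Printing Implicit Defensive.

Import GRing.Theory.
Local Open Scope classical_set_scope.
Local Open Scope ring_scope.

Identity Coercion fun_of_set : set >-> Funclass.

Record subgroup (G : zmodType) := Subgroup {
  sgset :> set G;
  sgP : zmod_closed [in sgset] }.

Section Subgroups.
Variables (G : zmodType) (S : subgroup G).

Definition sgpred : {pred G} := [in (S : set G)].
HB.instance Definition _ := GRing.isZmodClosed.Build G sgpred (sgP S).

Record subg := Subg { sgval : G; sgvalP : sgpred sgval }.
HB.instance Definition _ := [isSub for sgval].
HB.instance Definition _ := [Choice of subg by <:].
HB.instance Definition _ := [SubChoice_isSubZmodule of subg by <:].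

Lemma sgvalB : {morph sgval : x y / x - y}.
Proof. exact: (raddfB (val : subg -> G)). Qed.
HB.instance Definition _ := GRing.isZmodMorphism.Build subg G sgval sgvalB.

Definition quotg := Quotient.quot sgpred.
HB.instance Definition _ := GRing.Zmodule.on quotg.

Definition qcls (x : G) : quotg := (\pi_(Quotient.quot sgpred) x)%qT.

Lemma qclsB : {morph qcls : x y / x - y}.
Proof. by move=> x y; rewrite /qcls raddfB. Qed.
HB.instance Definition _ := GRing.isZmodMorphism.Build G quotg qcls qclsB.

End Subgroups.

Lemma mk_zmod_closed (G : zmodType) (S : set G) :
  S 0 -> (forall x y, S x -> S y -> S (x - y)) -> zmod_closed [in S].
Proof.
move=> S0 SB; split; first exact: mem_set.
by move=> x y /set_mem Sx /set_mem Sy; apply/mem_set/SB.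
Qed.

Lemma sg0 (G : zmodType) (S : subgroup G) : S 0.
Proof. by case: (sgP S) => /set_mem. Qed.

Lemma sgB (G : zmodType) (S : subgroup G) x y : S x -> S y -> S (x - y).
Proof.
by move=> Sx Sy; case: (sgP S) => _ /(_ x y) H; apply/set_mem/H; apply/mem_set.
Qed.

Section Generated.
Variables (G : zmodType) (X : set G).

Definition gen_set : set G := smallest (fun H => zmod_closed [in H]) X.

Lemma gen_closed : zmod_closed [in gen_set].
Proof.
apply: mk_zmod_closed => [H /= [HP _]|x y Sx Sy H /= HH].
  exact: (sg0 (Subgroup HP)).
by case: (HH) => HP _; apply: (sgB (S := Subgroup HP)); [apply: Sx|apply: Sy].
Qed.

Definition gen : subgroup G := Subgroup gen_closed.
End Generated.

Section Preimage.
Variables (G H : zmodType) (f : {additive G -> H}) (S : subgroup H).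
Lemma preim_closed : zmod_closed [in f @^-1` S].
Proof.
apply: mk_zmod_closed => [|x y]; first by rewrite /preimage/= raddf0; apply: sg0.
by rewrite /preimage/= raddfB; apply: sgB.
Qed.
Definition preim_sg : subgroup G := Subgroup preim_closed.
End Preimage.

Section Image.
Variables (G H : zmodType) (f : {additive G -> H}).
Lemma range_closed : zmod_closed [in range f].
Proof.
apply: mk_zmod_closed => [|_ _ [x _ <-] [y _ <-]]; first by exists 0; rewrite ?raddf0.
by exists (x - y); rewrite ?raddfB.
Qed.
Definition range_sg : subgroup H := Subgroup range_closed.
End Image.

Section DirectSum.
Variables (J : Type) (G : J -> zmodType).

Record dsum := DSum {
  dsval :> forall i, G i;
  dsvalP : finite_set [set i | dsval i != 0] }.

HB.instance Definition _ := gen_eqMixin dsum.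
HB.instance Definition _ := gen_choiceMixin dsum.

Lemma dsum_eq (f g : dsum) : (forall i, f i = g i) -> f = g.
Proof.
case: f g => f fP [g gP] /= fg.
have efg : f = g by apply: functional_extensionality_dep.
by case: g / efg gP {fg} => gP; congr DSum; apply: Prop_irrelevance.
Qed.

Lemma dsum0P : finite_set [set i | (0 : G i) != 0].
Proof.
rewrite (_ : [set i | _] = set0); first exact: finite_set0.
by rewrite -subset0 => i /=; rewrite eqxx.
Qed.

Lemma dsumDP (f g : dsum) : finite_set [set i | f i + g i != 0].
Proof.
apply: (@sub_finite_set _ _ ([set i | f i != 0] `|` [set i | g i != 0])).
  move=> i /= fg; case: (eqVneq (f i) 0) => [f0|]; last by left.
  by right; move: fg; rewrite f0 add0r.
by rewrite finite_setU; split; apply: dsvalP.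
Qed.

Lemma dsumNP (f : dsum) : finite_set [set i | - f i != 0].
Proof.
by apply: sub_finite_set (dsvalP f) => i /=; rewrite oppr_eq0.
Qed.

Definition ds0 := DSum dsum0P.
Definition dsD f g := DSum (dsumDP f g).
Definition dsN f := DSum (dsumNP f).

Lemma dsDA : associative dsD.
Proof. by move=> f g h; apply: dsum_eq => i /=; rewrite addrA. Qed.
Lemma dsDC : commutative dsD.
Proof. by move=> f g; apply: dsum_eq => i /=; rewrite addrC. Qed.
Lemma ds0D : left_id ds0 dsD.
Proof. by move=> f; apply: dsum_eq => i /=; rewrite add0r. Qed.
Lemma dsND : left_inverse ds0 dsN dsD.
Proof. by move=> f; apply: dsum_eq => i /=; rewrite addNr. Qed.

HB.instance Definition _ := GRing.isZmodule.Build dsum dsDA dsDC ds0D dsND.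
End DirectSum.

Definition short_exact (G1 G2 G3 : zmodType)
    (f : {additive G1 -> G2}) (g : {additive G2 -> G3}) :=
  [/\ injective f, range f = [set x | g x = 0] & range g = setT].

Definition isog (G H : zmodType) := exists f : {additive G -> H}, bijective f.

Section Flat.
Variable D : comNzRingType.

(* A sequence [:: (x1, y1); ...; (xn, yn)] stands for the element
   x1 (x) y1 + ... + xn (x) yn of the tensor product of N and M over D;
   [tensor_eq] is equality in the tensor product, i.e. the congruence on formal
   sums generated by the bilinearity relations. *)
Inductive tensor_eq (N M : lmodType D) : seq (N * M) -> seq (N * M) -> Prop :=
| tensor_refl s : tensor_eq s s
| tensor_sym s t : tensor_eq s t -> tensor_eq t s
| tensor_trans s t u : tensor_eq s t -> tensor_eq t u -> tensor_eq s u
| tensor_cat s s' t t' :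
    tensor_eq s s' -> tensor_eq t t' -> tensor_eq (s ++ t) (s' ++ t')
| tensor_catC s t : tensor_eq (s ++ t) (t ++ s)
| tensor_0 y : tensor_eq [:: (0, y)] [::]
| tensor_Dl x x' y : tensor_eq [:: (x + x', y)] [:: (x, y); (x', y)]
| tensor_Dr x y y' : tensor_eq [:: (x, y + y')] [:: (x, y); (x, y')]
| tensor_Z a x y : tensor_eq [:: (a *: x, y)] [:: (x, a *: y)].

Definition flat (M : lmodType D) :=
  forall (N N' : lmodType D) (f : {linear N -> N'}), injective f ->
  forall s t : seq (N * M),
    tensor_eq [seq (f p.1, p.2) | p <- s] [seq (f p.1, p.2) | p <- t] ->
    tensor_eq s t.
End Flat.

(* All the integral domains of interest live in a common field [F], so that the
   quotient field of each of them is a subset of [F]. *)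

Record subring (F : fieldType) := Subring {
  srset :> set F;
  srP : subring_closed [in srset] }.

Section Ideals.
Variable F : fieldType.
Implicit Types (A B : subring F) (X Y Z I J : set F).

Definition qf A : set F :=
  [set x | exists a b, [/\ A a, A b, b != 0 & x = a / b]].

(* finite sums of products x * y; this is both the product of ideals, the
   extension I T of an ideal, and the compositum R T of two rings *)
Definition mulI X Y : set F :=
  [set z | exists2 s : seq (F * F),
     {in s, forall p, X p.1 /\ Y p.2} & z = \sum_(p <- s) p.1 * p.2].

Definition submod A I :=
  [/\ I 0, forall x y, I x -> I y -> I (x + y)
    & forall a x, A a -> I x -> I (a * x)].

Definition ideal A I := I `<=` A /\ submod A I.

Definition frac_ideal A I :=
  [/\ I `<=` qf A, submod A I
    & exists b, [/\ A b, b != 0 & forall x, I x -> A (b * x)]].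

Definition prin A (x : F) : set F := [set x * a | a in A].

Definition invertible A I :=
  frac_ideal A I /\ exists2 J, frac_ideal A J & mulI I J = A.

Definition integral A I := I `<=` A.

(* unitary with respect to A, for I a fractional ideal of some larger ring *)
Definition unitary A I := I `&` qf A <> [set 0].

(* [B] is pseudo-polynomial over [A] *)
Definition pseudo_polynomial B A :=
  forall b, B b -> unitary A (prin B b) ->
  exists2 a, A a & prin B b = prin B a.

Lemma sr1 A : A 1. Proof. by case: (srP A) => /set_mem. Qed.
Lemma srB A x y : A x -> A y -> A (x - y).
Proof.
by move=> Ax Ay; case: (srP A) => _ /(_ x y) H _; apply/set_mem/H; apply/mem_set.
Qed.
Lemma srM A x y : A x -> A y -> A (x * y).
Proof.
by move=> Ax Ay; case: (srP A) => _ _ /(_ x y) H; apply/set_mem/H; apply/mem_set.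
Qed.
Lemma sr0 A : A 0. Proof. by rewrite -(subrr 1); apply: srB; apply: sr1. Qed.
Lemma srN A x : A x -> A (- x).
Proof. by move=> Ax; rewrite -sub0r; apply: srB => //; apply: sr0. Qed.
Lemma srD A x y : A x -> A y -> A (x + y).
Proof. by move=> Ax Ay; rewrite -[y]opprK; apply: srB => //; apply: srN. Qed.

Lemma mk_subring_closed X : X 1 -> (forall x y, X x -> X y -> X (x - y)) ->
  (forall x y, X x -> X y -> X (x * y)) -> subring_closed [in X].
Proof.
move=> X1 XB XM; split; first exact: mem_set.
  by move=> x y /set_mem Xx /set_mem Xy; apply/mem_set/XB.
by move=> x y /set_mem Xx /set_mem Xy; apply/mem_set/XM.
Qed.

Lemma qf_sub A : A `<=` qf A.
Proof. by move=> a Aa; exists a, 1; split; rewrite ?oner_eq0 ?divr1//; apply: sr1. Qed.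

Lemma qf_D A x y : qf A x -> qf A y -> qf A (x + y).
Proof.
move=> [a [b [Aa Ab b0 ->]]] [c [d [Ac Ad d0 ->]]].
exists (a * d + c * b), (b * d); split; rewrite ?mulf_neq0 ?addf_div//.
  by apply: srD; apply: srM.
exact: srM.
Qed.

Lemma qf_M A x y : qf A x -> qf A y -> qf A (x * y).
Proof.
move=> [a [b [Aa Ab b0 ->]]] [c [d [Ac Ad d0 ->]]].
by exists (a * c), (b * d); split; rewrite ?mulf_neq0 ?mulf_div//; apply: srM.
Qed.

Lemma qf_V A x : qf A x -> qf A x^-1.
Proof.
move=> [a [b [Aa Ab b0 ->]]]; have [->|a0] := eqVneq a 0.
  by rewrite mul0r invr0; apply/qf_sub/sr0.
by exists b, a; split=> //; rewrite invf_div.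
Qed.

Lemma qf_mono A B : A `<=` B -> qf A `<=` qf B.
Proof.
by move=> sAB x [a [b [Aa Ab b0 ->]]]; exists a, b; split=> //; apply: sAB.
Qed.

Lemma mulI0 X Y : mulI X Y 0.
Proof. by exists [::] => //; rewrite big_nil. Qed.

Lemma mulID X Y x y : mulI X Y x -> mulI X Y y -> mulI X Y (x + y).
Proof.
move=> [s sP ->] [t tP ->]; exists (s ++ t); last by rewrite big_cat.
by move=> p; rewrite mem_cat => /orP[/sP|/tP].
Qed.

Lemma mulI_in X Y x y : X x -> Y y -> mulI X Y (x * y).
Proof.
move=> Xx Yy; exists [:: (x, y)]; last by rewrite big_seq1.
by move=> p; rewrite inE => /eqP ->.
Qed.

Lemma mulI_ind X Y Z : Z 0 -> (forall x y, Z x -> Z y -> Z (x + y)) ->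
  (forall x y, X x -> Y y -> Z (x * y)) -> mulI X Y `<=` Z.
Proof.
move=> Z0 ZD ZM _ [s sP ->]; elim: s sP => [|p s IH] sP; first by rewrite big_nil.
rewrite big_cons; apply: ZD.
  by case: (sP p); rewrite ?mem_head// => ? ?; apply: ZM.
by apply: IH => q qs; apply: sP; rewrite inE qs orbT.
Qed.

Lemma mulIC_sub X Y : mulI X Y `<=` mulI Y X.
Proof.
apply: mulI_ind => [|x y|x y Xx Yy]; [exact: mulI0|exact: mulID|].
by rewrite mulrC; apply: mulI_in.
Qed.

Lemma mulIC X Y : mulI X Y = mulI Y X.
Proof. by apply/seteqP; split; apply: mulIC_sub. Qed.

Lemma mulI_subl X X' Y : X `<=` X' -> mulI X Y `<=` mulI X' Y.
Proof.
move=> sX; apply: mulI_ind => [|x y|x y Xx Yy];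
  [exact: mulI0|exact: mulID|by apply: mulI_in => //; apply: sX].
Qed.

Lemma mulIA_sub X Y Z : mulI X (mulI Y Z) `<=` mulI (mulI X Y) Z.
Proof.
apply: mulI_ind => [|x y|x w Xx]; [exact: mulI0|exact: mulID|].
move: w; apply: (mulI_ind (Z := fun w => mulI (mulI X Y) Z (x * w))).
- by rewrite mulr0; apply: mulI0.
- by move=> a b; rewrite mulrDr; apply: mulID.
- by move=> y z Yy Zz; rewrite mulrA; apply: mulI_in => //; apply: mulI_in.
Qed.

Lemma mulIA : associative mulI.
Proof.
move=> X Y Z; apply/seteqP; split; first exact: mulIA_sub.
by rewrite [mulI X (mulI Y Z)]mulIC [mulI Y Z]mulIC
  [mulI (mulI X Y) Z]mulIC [mulI X Y]mulIC; apply: mulIA_sub.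
Qed.

Lemma mulI_submod A I J : submod A I -> submod A (mulI I J).
Proof.
move=> [I0 ID IM]; split; [exact: mulI0|exact: mulID|].
move=> a x Aa; move: x; apply: (mulI_ind (Z := fun x => mulI I J (a * x))).
- by rewrite mulr0; apply: mulI0.
- by move=> x y; rewrite mulrDr; apply: mulID.
- by move=> x y Ix Jy; rewrite mulrA; apply: mulI_in => //; apply: IM.
Qed.

Lemma submod_sub A B I : A `<=` B -> submod B I -> submod A I.
Proof. by move=> sAB [I0 ID IM]; split=> // a x /sAB; apply: IM. Qed.

Lemma mul1I A I : submod A I -> mulI A I = I.
Proof.
move=> [I0 ID IM]; apply/seteqP; split; first exact: mulI_ind.
by move=> x Ix; rewrite -[x]mul1r; apply: mulI_in => //; apply: sr1.
Qed.

Lemma submod_sr A : submod A A.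
Proof. by split; [exact: sr0|move=> x y; exact: srD|move=> a x; exact: srM]. Qed.

Lemma frac_sr A : frac_ideal A A.
Proof.
split; [exact: qf_sub|exact: submod_sr|].
by exists 1; split; [exact: sr1|exact: oner_neq0|move=> x; rewrite mul1r].
Qed.

Lemma frac_mul A I J : frac_ideal A I -> frac_ideal A J -> frac_ideal A (mulI I J).
Proof.
move=> [Iq Im [b [Ab b0 bI]]] [Jq Jm [c [Ac c0 cJ]]]; split.
- apply: mulI_ind => [|x y|x y /Iq + /Jq]; first exact/qf_sub/sr0.
    exact: qf_D.
  exact: qf_M.
- exact: mulI_submod.
exists (b * c); split; [exact: srM|exact: mulf_neq0|].
apply: (mulI_ind (Z := fun x => A (b * c * x))).
- by rewrite mulr0; apply: sr0.
- by move=> x y; rewrite mulrDr; apply: srD.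
- by move=> x y Ix Jy; rewrite mulrACA; apply: srM; [apply: bI|apply: cJ].
Qed.

Definition colonI A I : set F :=
  [set x | qf A x /\ forall y, I y -> A (x * y)].

Lemma colonI_eq A I J : frac_ideal A I -> frac_ideal A J -> mulI I J = A ->
  colonI A I = J.
Proof.
move=> fI [Jq [J0 JD JM] _] IJ; apply/seteqP; split; last first.
  move=> x Jx; split; first exact: Jq.
  by move=> y Iy; rewrite -IJ mulrC; apply: mulI_in.
move=> x [_ xI]; rewrite -[x]mulr1.
have : mulI I J 1 by rewrite IJ; apply: sr1.
move: 1; apply: (mulI_ind (Z := fun z => J (x * z))).
- by rewrite mulr0.
- by move=> a b; rewrite mulrDr; apply: JD.
- by move=> a b Ia Jb; rewrite mulrA; apply: JM => //; apply: xI.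
Qed.

(* The group of invertible ideals is written additively, as a [zmodType]: [0] is
   the unit ideal [A] and [I + J] is the product ideal [mulI I J]. *)

Record InvI A := MkInv { ival :> set F; invP : invertible A ival }.

Section InvGroup.
Variable A : subring F.

HB.instance Definition _ := gen_eqMixin (InvI A).
HB.instance Definition _ := gen_choiceMixin (InvI A).

Lemma Inv_eq (I J : InvI A) : (I : set F) = J -> I = J.
Proof.
case: I J => I IP [J JP] /= e; case: J / e JP => JP.
by congr MkInv; apply: Prop_irrelevance.
Qed.

Lemma Inv_submod (I : InvI A) : submod A I.
Proof. by case: (invP I) => -[]. Qed.

Lemma inv0P : invertible A A.
Proof.
by split; [|exists A; last by rewrite mul1I//; apply: submod_sr]; apply: frac_sr.
Qed.

Lemma invMP (I J : InvI A) : invertible A (mulI I J).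
Proof.
case: I J => I /= [fI [I' fI' eI]] [J /= [fJ [J' fJ' eJ]]].
split; first exact: frac_mul.
exists (mulI I' J'); first exact: frac_mul.
rewrite mulIA -[mulI (mulI I J) I']mulIA [mulI J I']mulIC mulIA eI -mulIA eJ.
by rewrite mul1I//; apply: submod_sr.
Qed.

Lemma mulI_colon (I : InvI A) : mulI I (colonI A I) = A.
Proof. by case: (invP I) => fI [J fJ e]; rewrite (colonI_eq fI fJ e). Qed.

Lemma invVP (I : InvI A) : invertible A (colonI A I).
Proof.
case: (invP I) => fI [J fJ e]; rewrite (colonI_eq fI fJ e); split=> //.
by exists I => //; rewrite mulIC.
Qed.

Definition inv0 := MkInv inv0P.
Definition invM (I J : InvI A) := MkInv (invMP I J).
Definition invV (I : InvI A) := MkInv (invVP I).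

Lemma invMA : associative invM.
Proof. by move=> I J L; apply: Inv_eq; rewrite /= mulIA. Qed.
Lemma invMC : commutative invM.
Proof. by move=> I J; apply: Inv_eq; rewrite /= mulIC. Qed.
Lemma inv1M : left_id inv0 invM.
Proof. by move=> I; apply: Inv_eq; rewrite /= mul1I//; apply: Inv_submod. Qed.
Lemma invVM : left_inverse inv0 invV invM.
Proof. by move=> I; apply: Inv_eq; rewrite /= mulIC mulI_colon. Qed.

HB.instance Definition _ := GRing.isZmodule.Build (InvI A) invMA invMC inv1M invVM.

Lemma InvD (I J : InvI A) : (I + J : InvI A) = mulI I J :> set F.
Proof. by []. Qed.

Lemma prin_mul x y : mulI (prin A x) (prin A y) = prin A (x * y).
Proof.
apply/seteqP; split.
  apply: mulI_ind => [|_ _ [a Aa <-] [b Ab <-]|_ _ [a Aa <-] [b Ab <-]].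
  - by exists 0; rewrite ?mulr0//; apply: sr0.
  - by exists (a + b); rewrite ?mulrDr//; apply: srD.
  - by exists (a * b); rewrite 1?mulrACA//; apply: srM.
move=> _ [a Aa <-]; have -> : x * y * a = x * 1 * (y * a) by rewrite mulr1 mulrA.
by apply: mulI_in; [exists 1; first exact: sr1|exists a].
Qed.

Lemma prin_frac x : qf A x -> frac_ideal A (prin A x).
Proof.
move=> qx; split.
- by move=> _ [a Aa <-]; apply: qf_M => //; apply: qf_sub.
- split; first by exists 0; rewrite ?mulr0//; apply: sr0.
    by move=> _ _ [a Aa <-] [b Ab <-]; exists (a + b); rewrite ?mulrDr//; apply: srD.
  by move=> a _ Aa [b Ab <-]; exists (a * b); rewrite 1?mulrCA//; apply: srM.
case: qx => a [b [Aa Ab b0 ->]]; exists b; split=> // _ [c Ac <-].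
by rewrite mulrA mulrCA mulfV// mulr1; apply: srM.
Qed.

Lemma prin1 : prin A 1 = A.
Proof.
apply/seteqP; split=> [_ [a Aa <-]|a Aa]; first by rewrite mul1r.
by exists a; rewrite ?mul1r.
Qed.

Lemma prin_inv x : qf A x -> x != 0 -> invertible A (prin A x).
Proof.
move=> qx x0; split; first exact: prin_frac.
exists (prin A x^-1); first by apply/prin_frac/qf_V.
by rewrite prin_mul mulfV// prin1.
Qed.

Definition Princ_set : set (InvI A) :=
  [set I : InvI A | exists x, [/\ qf A x, x != 0 & I = prin A x :> set F]].

Lemma Princ_closed : zmod_closed [in Princ_set].
Proof.
apply: mk_zmod_closed => [|I J [x [qx x0 eI]] [y [qy y0 eJ]]].
  by exists 1; split; [exact/qf_sub/sr1|exact: oner_neq0|rewrite prin1].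
exists (x / y); split; [by apply: qf_M => //; apply: qf_V
  |by rewrite mulf_neq0 ?invr_neq0|].
rewrite InvD eI -prin_mul; congr mulI; rewrite /= eJ.
by apply: colonI_eq; rewrite ?prin_mul ?mulfV ?prin1//; apply: prin_frac => //;
  apply: qf_V.
Qed.

Definition Princ : subgroup (InvI A) := Subgroup Princ_closed.
End InvGroup.

Definition Pic A := quotg (Princ A).

Section Ext.
Variables (A B : subring F).
Hypothesis sAB : A `<=` B.

Lemma ext_frac I : frac_ideal A I -> frac_ideal B (mulI I B).
Proof.
move=> [Iq Im [b [Ab b0 bI]]]; split.
- apply: mulI_ind => [|x y|x y /Iq/(qf_mono sAB) + /qf_sub]; first exact/qf_sub/sr0.
    exact: qf_D.
  exact: qf_M.
- by rewrite mulIC; apply/mulI_submod/submod_sr.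
exists b; split=> //; first exact: sAB.
apply: (mulI_ind (Z := fun x => B (b * x))).
- by rewrite mulr0; apply: sr0.
- by move=> x y; rewrite mulrDr; apply: srD.
- by move=> x y Ix Jy; rewrite mulrA; apply: srM => //; apply/sAB/bI.
Qed.

Lemma ext_mul I J : mulI (mulI I J) B = mulI (mulI I B) (mulI J B).
Proof.
rewrite mulIA -[mulI (mulI I B) J]mulIA [mulI B J]mulIC !mulIA -!mulIA mul1I//.
exact: submod_sr.
Qed.

Lemma ext_one : mulI A B = B.
Proof. by rewrite mul1I//; apply/(submod_sub sAB)/submod_sr. Qed.

Lemma ext_invP (I : InvI A) : invertible B (mulI I B).
Proof.
case: (invP I) => fI [J fJ e]; split; first exact: ext_frac.
by exists (mulI J B); [exact: ext_frac|rewrite -ext_mul e ext_one].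
Qed.

Definition ext (I : InvI A) : InvI B := MkInv (ext_invP I).

Lemma extD : {morph ext : x y / x + y}.
Proof. by move=> x y; apply: Inv_eq; rewrite /= ext_mul. Qed.

Lemma extB : {morph ext : x y / x - y}.
Proof.
move=> x y; apply: (@addIr _ (ext y)).
by rewrite -extD !subrK.
Qed.
HB.instance Definition _ := GRing.isZmodMorphism.Build (InvI A) (InvI B) ext extB.


Lemma ext_integral (I : InvI A) : integral A I -> integral B (ext I).
Proof.
move=> IA; apply: mulI_ind => [|x y|x y /IA/sAB + By].
- exact: sr0.
- exact: srD.
- by move/srM; apply.
Qed.

Lemma ext_incl (I : InvI A) : I `<=` ext I.
Proof. by move=> x Ix; rewrite -[x]mulr1; apply: mulI_in => //; apply: sr1. Qed.
End Ext.

Definition Invu B A : subgroup (InvI B) :=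
  gen [set I : InvI B | integral B I /\ unitary A I].

Definition Princu B A : subgroup (subg (Invu B A)) :=
  preim_sg (@sgval _ (Invu B A)) (Princ B).

Definition Picu B A := quotg (Princu B A).

Lemma unitaryP A I x : I x -> qf A x -> x != 0 -> unitary A I.
Proof. by move=> Ix qx /eqP x0 /seteqP[/(_ x (conj Ix qx))/x0]. Qed.

Lemma unitary_ex A I : I 0 -> unitary A I -> exists x, [/\ I x, qf A x & x != 0].
Proof.
move=> I0 uI; apply: contrapT => H; apply: uI; apply/seteqP; split=> x.
  move=> [Ix qx] /=; apply: contrapT => /eqP x0; apply: H; exists x.
  by split.
by move=> ->; split=> //; apply/qf_sub/sr0.
Qed.

Lemma Inv_nonzero A (I : InvI A) : exists2 x, I x & x != 0.
Proof.
apply: contrapT => H; have := sr1 A; rewrite -(mulI_colon I).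
move=> /(@mulI_ind _ _ [set 0]); rewrite /= => /(_ erefl) K.
suff : 1 = 0 :> F by move/eqP; rewrite oner_eq0.
apply: K => [x y -> ->|x y Ix _]; first by rewrite addr0.
have [->|x0] := eqVneq x 0; first by rewrite mul0r.
by case: H; exists x.
Qed.

Section ExtU.
Variables (A B : subring F) (sAB : A `<=` B).

Lemma ext_integral_Invu (I : InvI A) : integral A I -> Invu B A (ext sAB I).
Proof.
move=> IA H [_]; apply; split; first exact: ext_integral.
have [x Ix x0] := Inv_nonzero I.
by apply: (unitaryP (x := x)) => //; [apply: ext_incl|apply/qf_sub/IA].
Qed.

Lemma ext_Invu (I : InvI A) : Invu B A (ext sAB I).
Proof.
case: (invP I) => -[Iq Im [b [Ab b0 bI]]] _.
pose P : InvI A := MkInv (prin_inv (qf_sub Ab) b0).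
have -> : I = P + I - P by rewrite addrC addKr.
rewrite raddfB; apply: sgB; apply: ext_integral_Invu.
  apply: mulI_ind => [|x y|_ y [a Aa <-] Iy]; [exact: sr0|exact: srD|].
  by rewrite mulrAC; apply: srM => //; apply: bI.
by move=> _ [a Aa <-]; apply: srM.
Qed.

Definition extu (I : InvI A) : subg (Invu B A) := Subg (mem_set (ext_Invu I)).

Lemma extuB : {morph extu : x y / x - y}.
Proof. by move=> x y; apply: val_inj; rewrite /= raddfB. Qed.
HB.instance Definition _ :=
  GRing.isZmodMorphism.Build (InvI A) (subg (Invu B A)) extu extuB.

(* the image of Pic(A) -> Pic_u(B,A), [I] |-> [IB] *)
Definition Pic_image : subgroup (Picu B A) :=
  range_sg (@qcls _ (Princu B A) \o extu).

Definition LPicu := quotg Pic_image.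
End ExtU.

Section ExtUU.
Variables (A B A' B' : subring F) (sAA' : A `<=` A') (sBB' : B `<=` B').

Lemma ext_uuP (I : subg (Invu B A)) : Invu B' A' (ext sBB' (sgval I)).
Proof.
case: I => I /= /set_mem HI.
apply: (HI (preim_sg (ext sBB') (Invu B' A'))); split; first exact: sgP.
move=> J [Ji Ju] H [_]; apply; split; first exact: ext_integral.
have [J0 _ _] := Inv_submod J.
have [x [Jx qx x0]] := unitary_ex J0 Ju.
by apply: (unitaryP (x := x)) => //; [apply: ext_incl|apply: qf_mono qx].
Qed.

Definition extuu (I : subg (Invu B A)) : subg (Invu B' A') :=
  Subg (mem_set (ext_uuP I)).
End ExtUU.

Lemma compositum_closed A B : subring_closed [in mulI A B].
Proof.
have h a : A a -> forall x, mulI A B x -> mulI A B (a * x).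
  by move=> Aa x; have [_ _ /(_ a x Aa)] := mulI_submod B (submod_sr A).
apply: mk_subring_closed.
- by rewrite -[1]mulr1; apply: mulI_in; apply: sr1.
- move=> x y Hx Hy; apply: mulID => //.
  by rewrite -mulN1r; apply: h => //; apply/srN/sr1.
move=> x y Hx Hy.
have -> : (mulI A B : set F) = mulI (mulI A B) (mulI A B).
  rewrite mulIA -[mulI (mulI A B) A]mulIA [mulI B A]mulIC mulIA.
  by rewrite (mul1I (submod_sr A)) -mulIA (mul1I (submod_sr B)).
exact: mulI_in.
Qed.

Definition compositum A B : subring F := Subring (compositum_closed A B).

Lemma compositum_subl A B : A `<=` compositum A B.
Proof. by move=> x Ax; rewrite -[x]mulr1; apply: mulI_in => //; apply: sr1. Qed.

Lemma compositum_subr A B : B `<=` compositum A B.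
Proof. by move=> x Bx; rewrite -[x]mul1r; apply: mulI_in => //; apply: sr1. Qed.

Record overring A := Overring {
  orring :> subring F;
  orl : A `<=` orring;
  orr : orring `<=` qf A }.

End Ideals.

Section Jaffard.
Variables (D R : idomainType) (phi : {rmorphism D -> R}).
Local Notation L := {fraction R}.

Definition retract := exists eps : {rmorphism R -> D}, cancel phi eps.

Definition algR (x : R) : L := tofrac x.
Definition algD (x : D) : L := tofrac (phi x).

Lemma Rsub_closed : subring_closed [in range algR].
Proof.
apply: mk_subring_closed => [|_ _ [x _ <-] [y _ <-]|_ _ [x _ <-] [y _ <-]].
- by exists 1; rewrite // /algR rmorph1.
- by exists (x - y); rewrite // /algR rmorphB.
- by exists (x * y); rewrite // /algR rmorphM.
Qed.

Lemma Dsub_closed : subring_closed [in range algD].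
Proof.
apply: mk_subring_closed => [|_ _ [x _ <-] [y _ <-]|_ _ [x _ <-] [y _ <-]].
- by exists 1; rewrite // /algD !rmorph1.
- by exists (x - y); rewrite // /algD !rmorphB.
- by exists (x * y); rewrite // /algD !rmorphM.
Qed.

(* the copies of R and D inside the quotient field of R *)
Definition Rsub : subring L := Subring Rsub_closed.
Definition Dsub : subring L := Subring Dsub_closed.

Lemma DsubR : Dsub `<=` Rsub.
Proof. by move=> _ [x _ <-]; exists (phi x). Qed.

(* T is isomorphic, as a D-submodule of the quotient field of R, to a flat
   D-module *)
Definition flat_sub (T : set L) :=
  exists (M : lmodType D) (j : {additive M -> L}),
    [/\ injective j, range j = T, forall a m, j (a *: m) = algD a * j m & flat M].

(* only used for nonzero x in T, where being a unit of T means that 1/x is in T *)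
Definition nonunit (T : subring L) (x : L) := ~ T x^-1.

Record jaffard (Theta : set (overring Dsub)) : Prop := Jaffard {
  jaffard_flat : forall T, Theta T -> flat_sub T;
  jaffard_proper : forall T, Theta T -> (T : set L) <> qf Dsub;
  jaffard_complete : forall I, ideal Dsub I ->
    I = \bigcap_(T in Theta) mulI I T;
  jaffard_independent : forall T T', Theta T -> Theta T' -> T <> T' ->
    mulI T T' = qf Dsub;
  jaffard_finite : forall x, Dsub x -> x != 0 ->
    finite_set [set T | Theta T /\ nonunit T x] }.

Variable Theta : set (overring Dsub).

(* [Princ T (ext _ I)] says that IT is principal *)
Definition PicTheta_set : set (Pic Dsub) :=
  [set c | exists2 I : InvI Dsub, c = qcls (Princ Dsub) I
     & forall T, Theta T -> Princ T (ext (@orl _ _ T) I)].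

Lemma PicTheta_closed : zmod_closed [in PicTheta_set].
Proof.
apply: mk_zmod_closed => [|_ _ [I -> HI] [J -> HJ]].
  by exists 0 => [|T _]; rewrite ?raddf0//; apply: sg0.
exists (I - J) => [|T TT]; first by rewrite raddfB.
by rewrite raddfB; apply: sgB; [apply: HI|apply: HJ].
Qed.

Definition PicTheta : subgroup (Pic Dsub) := Subgroup PicTheta_closed.

End Jaffard.

(* Main.v *)
Require Import Defs.
From HB Require Import structures.
From mathcomp Require Import all_boot all_algebra.
From mathcomp Require Import boolp classical_sets functions cardinality.
Import GRing.Theory.
Local Open Scope classical_set_scope.
Local Open Scope ring_scope.

Set Implicit Arguments.
Unset Strict Implicit.
Unset Printing Implicit Defensive.

(* Flatness makes extension to T in Theta commute with finite intersections, and
   completeness makes a D-submodule of Frac(R) determined by its extensions to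
   the T in Theta. The retraction gives MR `&` K = M for D-submodules M of K.
   Hence an ideal I in Inv_u(R,D) whose extension to each RT comes from an
   invertible ideal J_T of T is the extension of I `&` K: one has
   (I `&` K) T = J_T, and the same argument for I^-1 provides the inverse of
   I `&` K. Pseudo-polynomiality of RT over T allows J_T to be principal as soon
   as IRT is, so this computes both the kernel of pi_Theta and the kernel of the
   induced map on the local Picard groups. For surjectivity, an integral unitary
   invertible ideal J of RT is the extension of J `&` R, which by independence
   becomes trivial over every other member of Theta and whose inverse is found
   locally thanks to local finiteness. *)

(** * Quotients and direct sums of abelian groups *)

Lemma additive_of (G H : zmodType) (f : G -> H) :
  {morph f : x y / x - y} -> exists g : {additive G -> H}, g =1 f.
Proof.
move=> fB.
pose g : {additive G -> H} :=
  HB.pack_for {additive G -> H} f (GRing.isZmodMorphism.Build G H f fB).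
by exists g.
Qed.

Section QuotientGroup.
Variables (G : zmodType) (S : subgroup G).

Lemma qcls_eq x y : qcls S x = qcls S y <-> S (x - y).
Proof.
split=> [/eqP|Sxy].
  by rewrite /qcls -Quotient.idealrBE => /set_mem.
by apply/eqP; rewrite /qcls -Quotient.idealrBE; apply/mem_set.
Qed.

Lemma qcls_eq0 x : qcls S x = 0 <-> S x.
Proof. by rewrite -(raddf0 (qcls S)) qcls_eq subr0. Qed.

Lemma qcls_surj q : exists x, qcls S x = q.
Proof. by exists (repr q); rewrite /qcls reprK. Qed.

Lemma quotg_factor (H : zmodType) (f : {additive G -> H}) :
  (forall x, S x -> f x = 0) ->
  exists g : {additive quotg S -> H}, forall x, g (qcls S x) = f x.
Proof.
move=> fS; pose h (q : quotg S) := f (repr q).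
have hE x : h (qcls S x) = f x.
  apply/eqP; rewrite -subr_eq0 -raddfB; apply/eqP/fS/qcls_eq.
  by rewrite /qcls reprK.
have [|g gE] := @additive_of _ _ h; last by exists g => x; rewrite gE hE.
move=> p q; have [[x <-] [y <-]] := (qcls_surj p, qcls_surj q).
by rewrite -raddfB !hE raddfB.
Qed.

Lemma first_isog (H : zmodType) (f : {additive G -> H}) :
  range f = setT -> (forall x, f x = 0 <-> S x) -> isog (quotg S) H.
Proof.
move=> fT fS; have [x /fS //|g gE] := @quotg_factor H f.
exists g; have ginj : injective g.
  apply: raddf_inj => q; have [x <-] := qcls_surj q.
  by rewrite gE => /fS/qcls_eq0.
have /choice[h hK] : forall y, exists q, g q = y.
  move=> y; have : range f y by rewrite fT.
  by case=> x _ <-; exists (qcls S x).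
by exists h => // q; apply: ginj; rewrite hK.
Qed.

End QuotientGroup.

Section DirectSums.
Variables (J : Type) (Gs : J -> zmodType).

Lemma dsum_lift (G : zmodType) (f : forall i, {additive G -> Gs i}) :
  (forall x, finite_set [set i | f i x != 0]) ->
  exists g : {additive G -> dsum Gs}, forall x i, g x i = f i x.
Proof.
move=> fin; have [|g gE] := @additive_of G (dsum Gs) (fun x => DSum (fin x)).
  by move=> x y; apply: dsum_eq => i /=; rewrite raddfB.
by exists g => x i; rewrite gE.
Qed.

Lemma dsumB (f g : dsum Gs) i : (f - g) i = f i - g i. Proof. by []. Qed.

(** Elements concentrated at one index generate the direct sum: induction on a finite list covering
    the support, with one component subtracted at each step. *)
Lemma dsum_surj (G : zmodType) (g : {additive G -> dsum Gs}) :
  (forall i c, exists x, g x i = c /\ forall j, j <> i -> g x j = 0) ->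
  range g = setT.
Proof.
move=> single; apply/seteqP; split=> // f _.
have [s sE] := (@finite_seqP {classic J} _).1 (dsvalP f).
have {sE} : forall i, f i != 0 -> (i : {classic J}) \in s.
  by move=> i fi; have : [set i | f i != 0] i by []; rewrite sE.
elim: s f => [|i s IH] f fs.
  exists 0; rewrite // raddf0; apply: dsum_eq => i.
  by apply/esym/eqP; apply: contraT => /fs.
have [x [gxi gxj]] := single i (f i).
have [|y _ gy] := IH (f - g x); last first.
  by exists (y + x); rewrite // raddfD gy subrK.
move=> j; rewrite dsumB; have [->|/eqP ji] := eqVneq (j : {classic J}) i.
  by rewrite gxi subrr eqxx.
by rewrite (gxj _ ji) subr0 => /fs; rewrite inE => /orP[/eqP|].
Qed.

End DirectSums.

(** * Submodules of a field and the unitary group *)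

Section Submodules.
Variable F : fieldType.
Implicit Types (A B : subring F) (M N X Y Z I J : set F).

Lemma mulI_idem A : mulI A A = A.
Proof. exact/mul1I/submod_sr. Qed.

Lemma mulIA_AC X Y Z : mulI (mulI X Y) Z = mulI (mulI X Z) Y.
Proof. by rewrite -!mulIA [mulI Y Z]mulIC. Qed.

Lemma mulI_AC_AC X Y Z W :
  mulI (mulI X Y) (mulI Z W) = mulI (mulI X Z) (mulI Y W).
Proof. by rewrite mulIA [mulI (mulI X Y) Z]mulIA_AC -mulIA. Qed.

Lemma mulI_incl A X : X `<=` mulI X A.
Proof. by move=> x Xx; rewrite -[x]mulr1; apply: mulI_in => //; apply: sr1. Qed.

Lemma mulI1 A M : submod A M -> mulI M A = M.
Proof. by move=> ?; rewrite mulIC mul1I. Qed.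

Lemma submod_mulIr A X Y : submod A Y -> submod A (mulI X Y).
Proof. by move=> ?; rewrite mulIC; apply: mulI_submod. Qed.

Lemma submodI A M N : submod A M -> submod A N -> submod A (M `&` N).
Proof.
move=> [M0 MD MM] [N0 ND NM]; split=> //.
  by move=> x y [Mx Nx] [My Ny]; split; [apply: MD|apply: ND].
by move=> a x Aa [Mx Nx]; split; [apply: MM|apply: NM].
Qed.

Lemma qf_submod A : submod A (qf A).
Proof.
split; [exact/qf_sub/sr0|exact: qf_D|].
by move=> a x /qf_sub; apply: qf_M.
Qed.

Lemma qf_idem A B : A `<=` B -> B `<=` qf A -> qf B = qf A.
Proof.
move=> AB BA; apply/seteqP; split; last exact: qf_mono.
move=> _ [a [b [/BA qa /BA qb b0 ->]]].
by apply: qf_M => //; apply: qf_V.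
Qed.

Lemma prin_submod A x : submod A (prin A x).
Proof.
split; first by exists 0; rewrite ?mulr0//; apply: sr0.
  by move=> _ _ [a Aa <-] [b Ab <-]; exists (a + b); rewrite ?mulrDr//; apply: srD.
by move=> a _ Aa [b Ab <-]; exists (a * b); rewrite 1?mulrCA//; apply: srM.
Qed.

Lemma prin_self A x : prin A x x.
Proof. by exists 1; rewrite ?mulr1//; apply: sr1. Qed.

Lemma mulI_prin A x I : submod A I -> mulI (prin A x) I = [set x * y | y in I].
Proof.
move=> [I0 ID IM]; apply/seteqP; split=> [|_ [y Iy <-]]; last first.
  by apply: mulI_in => //; apply: prin_self.
apply: mulI_ind => [|_ _ [y Iy <-] [z Iz <-]|_ y [a Aa <-] Iy].
- by exists 0; rewrite ?mulr0.
- by exists (y + z); rewrite ?mulrDr//; apply: ID.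
- by exists (a * y); rewrite ?mulrA//; apply: IM.
Qed.

Lemma ext_prin A B x : A `<=` B -> mulI (prin A x) B = prin B x.
Proof. by move=> AB; rewrite mulI_prin//; apply/(submod_sub AB)/submod_sr. Qed.

Lemma prin_unit A x : A x -> A x^-1 -> x != 0 -> prin A x = A.
Proof.
move=> Ax Ax' x0; apply/seteqP; split=> [_ [a Aa <-]|a Aa]; first exact: srM.
by exists (x^-1 * a); rewrite ?mulVKf//; apply: srM.
Qed.

Lemma Inv_integral A I : frac_ideal A I -> integral A I ->
  forall e J, e != 0 -> qf A e -> frac_ideal A J -> mulI I J = prin A e ->
  invertible A I.
Proof.
move=> fI IA e J e0 qe fJ IJ; split=> //.
exists (mulI J (prin A e^-1)); first by apply/frac_mul/prin_frac/qf_V.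
by rewrite mulIA IJ prin_mul mulfV// prin1.
Qed.

Lemma integral_frac A I : submod A I -> I `<=` A -> frac_ideal A I.
Proof.
move=> sI IA; split=> //; first by move=> x /IA/qf_sub.
by exists 1; split; [exact: sr1|exact: oner_neq0|move=> x /IA; rewrite mul1r].
Qed.

End Submodules.

(** * Elementwise control of the group of unitary invertible ideals *)

Section UnitaryGroup.
Variables (F : fieldType) (A B : subring F).
Hypothesis sAB : A `<=` B.

(** A condition on elements that holds for the generators of [Invu] and is stable under the group
    law, so that it reaches all of [Invu]: it says that b B is contained in I and I in a^-1 B, with
    a and b nonzero in [A]. *)
Definition pinched : set (InvI B) := [set I : InvI B |
  exists a b, [/\ A a, a != 0, A b, b != 0 & I b /\ forall x, I x -> B (a * x)]].

Lemma pinched_closed : zmod_closed [in pinched].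
Proof.
apply: mk_zmod_closed.
  exists 1, 1; split; rewrite ?oner_neq0//; [exact: sr1|exact: sr1|split].
    exact: (@sr1 _ B).
  by move=> x; rewrite mul1r.
move=> I J [a [b [Aa a0 Ab b0 [Ib aI]]]] [c [d [Ac c0 Ad d0 [Jd cJ]]]].
(* Since [d] lies in J, it sends the inverse of J into [B]; since c J lies in [B], [c] belongs to
   that inverse. Hence the crossed witnesses. *)
exists (a * d), (b * c); split; rewrite ?mulf_neq0//; try exact: srM.
split.
  apply: mulI_in => //; split; first exact/qf_sub/sAB.
  by move=> y; apply: cJ.
apply: (@mulI_ind _ _ _ (fun x => B (a * d * x))).
- by rewrite mulr0; apply: sr0.
- by move=> x y; rewrite mulrDr; apply: srD.
move=> x y Ix [_ yJ]; rewrite mulrACA; apply: srM; first exact: aI.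
by rewrite mulrC; apply: yJ.
Qed.

Lemma Invu_pinched (I : InvI B) : Invu B A I -> pinched I.
Proof.
move=> HI; apply: (HI pinched); split=> [|J [JB uJ]]; first exact: pinched_closed.
have [J0 _ JM] := Inv_submod J.
have [x [Jx [p [q [Ap Aq q0 xE]]] x0]] := unitary_ex J0 uJ.
(* The numerator of x is a multiple of x by an element of [A], hence a nonzero element of [A] in
   J. *)
exists 1, p; split; rewrite ?oner_neq0//; first exact: sr1.
  by apply: contra x0; rewrite xE => /eqP ->; rewrite mul0r.
split; last by move=> y /JB; rewrite mul1r.
have -> : p = q * x by rewrite xE mulrCA mulfV ?mulr1.
by apply: JM => //; apply: sAB.
Qed.

(** If c I lies in [B] for a nonzero c of [A], then J = c I is integral and still contains a nonzero
    element of [A]; the principal factor is generated by c^-1. *)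
Lemma Invu_fraction (I : InvI B) : Invu B A I ->
  exists a (J : InvI B) (qa : qf A a) (a0 : a != 0),
    [/\ integral B J, unitary A J & I = J + MkInv (prin_inv (qf_mono sAB qa) a0)].
Proof.
move=> /Invu_pinched[a [b [Aa a0 Ab b0 [Ib aI]]]].
pose P : InvI B := MkInv (prin_inv (qf_mono sAB (qf_sub Aa)) a0).
have a'0 : a^-1 != 0 by rewrite invr_neq0.
exists a^-1, (I + P), (qf_V (qf_sub Aa)), a'0; split.
- apply: mulI_ind => [|x y|x _ /aI ax [c Bc <-]]; [exact: sr0|exact: srD|].
  by rewrite mulrA [x * a]mulrC; apply: srM.
- apply: (unitaryP (x := b * a)); last by rewrite mulf_neq0.
    by apply: mulI_in => //; apply: prin_self.
  by apply/qf_sub/srM.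
apply: Inv_eq; rewrite !InvD /= -mulIA prin_mul mulfV// prin1 mulI1//.
exact: Inv_submod.
Qed.

Hypothesis ppBA : pseudo_polynomial B A.

(** Moves a generator into the quotient field of [A]: if I = z B, a I lies in [B] and b is in I,
    then a z B is integral and contains a b, so it is generated by some c of [A] and I = (c / a)
    B. *)
Lemma Invu_principal (I : InvI B) : Invu B A I -> Princ B I ->
  exists x, [/\ qf A x, x != 0 & I = prin B x :> set F].
Proof.
move=> /Invu_pinched[a [b [Aa a0 Ab b0 [Ib aI]]]] [z [qz z0 Iz]].
have [||c Ac ec] := ppBA (b := a * z).
- by apply: aI; rewrite Iz; apply: prin_self.
- apply: (unitaryP (x := a * b)); last by rewrite mulf_neq0.
    by move: Ib; rewrite Iz => -[y By <-]; exists y; rewrite ?mulrA.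
  by apply/qf_sub/srM.
have c0 : c != 0.
  apply/eqP => c0; have := prin_self B (a * z).
  rewrite ec c0 => -[y _ /esym/eqP]; rewrite mul0r mulf_eq0.
  by rewrite (negPf a0) (negPf z0).
exists (c / a); split.
- by apply: qf_M; [exact: qf_sub|exact/qf_V/qf_sub].
- by rewrite mulf_neq0 ?invr_neq0.
by rewrite Iz -prin_mul -ec prin_mul mulrC mulKf.
Qed.

End UnitaryGroup.

(** * Local-global principles *)

Section LocalGlobal.
Variables (F : fieldType) (D : subring F).
Implicit Types (M N X : set F) (T : subring F).

(** The colon ideal (M : x) of [D]; for x to lie in M means that it contains 1. *)
Definition conductor M (x : F) : set F := [set d | D d /\ M (d * x)].

Lemma conductor_submod M x : submod D M -> submod D (conductor M x).
Proof.
move=> [M0 MD MM]; split; first by split; rewrite ?mul0r//; apply: sr0.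
  move=> a b [Da Ma] [Db Mb]; split; first exact: srD.
  by rewrite mulrDl; apply: MD.
by move=> a b Da [Db Mb]; split; [exact: srM|rewrite -mulrA; apply: MM].
Qed.

(* For an overring [T], this is Richman's characterization of flatness. *)
Definition locally_trivial T := forall t, T t -> mulI (conductor D t) T 1.

Section OneOverring.
Variable T : subring F.
Hypothesis Tloc : locally_trivial T.

(** (M : x)(M : y) lies in (M : x + y), and (D : t) lies in (M : m t) for m in M, so becoming the
    unit ideal over [T] passes from the elements of [T] to those of M T. *)
Lemma conductor_mulI M x :
  submod D M -> mulI M T x -> mulI (conductor M x) T 1.
Proof.
move=> sM; have [M0 MD MM] := sM; move: x.
apply: (@mulI_ind _ _ _ (fun x => mulI (conductor M x) T 1)).
- apply: (@mulI_incl _ T); split; first exact: sr1.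
  by rewrite mulr0.
- move=> x y Hx Hy.
  have : mulI (mulI (conductor M x) (conductor M y)) (mulI T T) 1.
    by rewrite -[1]mulr1 -mulI_AC_AC; apply: mulI_in.
  rewrite mulI_idem; apply: mulI_subl; apply: mulI_ind.
  + by have [] := conductor_submod (x + y) sM.
  + by have [_ + _] := conductor_submod (x + y) sM.
  move=> a b [Da Ma] [Db Mb]; split; first exact: srM.
  by rewrite mulrDr; apply: MD; [rewrite mulrAC mulrC|rewrite -mulrA]; apply: MM.
- move=> m t Mm /Tloc; apply: mulI_subl => d [Dd Dt]; split=> //.
  by rewrite mulrCA mulrC; apply: MM.
Qed.

(** Writing 1 as a sum of d_i t_i with every d_i y in M gives y as the sum of (d_i y) t_i, where d_i
    y lies in both M and N. *)
Lemma mulI_setI_sub M N : submod D M -> submod D N ->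
  mulI M T `&` N `<=` mulI (M `&` N) T.
Proof.
move=> sM [N0 ND NM] y [/(conductor_mulI sM) + Ny].
rewrite -{2}[y]mul1r; move: 1.
apply: (@mulI_ind _ _ _ (fun z => mulI (M `&` N) T (z * y))).
- by rewrite mul0r; apply: mulI0.
- by move=> a b; rewrite mulrDl; apply: mulID.
move=> d t [Dd My] Tt; rewrite mulrAC; apply: mulI_in => //; split=> //.
exact: NM.
Qed.

Lemma mulI_setI M N : submod D M -> submod D N ->
  mulI (M `&` N) T = mulI M T `&` mulI N T.
Proof.
move=> sM sN; apply/seteqP; split.
  by move=> x Hx; split; move: x Hx; apply: mulI_subl => x [].
move=> x [Mx Nx].
(* The one-sided inclusion is used twice: x lies in (N ∩ M T) T, and N ∩ M T lies in (M ∩ N) T. *)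
have : mulI (N `&` mulI M T) T x.
  by apply: mulI_setI_sub => //; apply: mulI_submod.
rewrite -[mulI (M `&` N) T](mulI1 (A := T)); last exact/submod_mulIr/submod_sr.
by apply: mulI_subl => y [Ny My]; apply: mulI_setI_sub.
Qed.

Lemma mulI_bigcap (I : Type) (S : set I) (N : I -> set F) M :
  finite_set S -> submod D M -> (forall i, S i -> submod D (N i)) ->
  let P := M `&` \bigcap_(i in S) N i in
  submod D P /\ mulI P T = mulI M T `&` \bigcap_(i in S) mulI (N i) T.
Proof.
move=> /(@finite_seqP {classic I})[s ->] sM; elim: s => [|i s IH] sN P; rewrite {}/P.
  by rewrite set_nil !bigcap_set0 !setIT.
have [j js|sP eP] := IH; first by apply: sN; rewrite /= inE js orbT.
have sNi : submod D (N i) by apply: sN; rewrite /= mem_head.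
have -> : [set` i :: s] = i |` [set` s].
  apply/seteqP; split=> j; rewrite /= inE.
    by move=> /orP[/eqP|]; [left|right].
  by move=> [->|->]; rewrite ?eqxx ?orbT.
rewrite !bigcap_setU1 setICA; split; first exact: submodI.
by rewrite mulI_setI// eP setICA.
Qed.

End OneOverring.

Variable Theta : set (overring D).
Hypothesis Theta_loc : forall T : overring D, Theta T -> locally_trivial T.
Hypothesis Theta_complete : forall I, ideal D I ->
  I = \bigcap_(T in Theta) mulI I T.

(** Completeness speaks of ideals of [D]; it is applied to the ideal (N : x), which contains 1
    because its extension to every member of [Theta] does. *)
Lemma local_subset M N : submod D M -> submod D N ->
  (forall T : overring D, Theta T -> mulI M T `<=` mulI N T) -> M `<=` N.
Proof.
move=> sM sN MN x Mx.
suff [_] : conductor N x 1 by rewrite mul1r.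
rewrite [conductor N x]Theta_complete => [T TT|]; last first.
  by split=> [d []//|]; apply: conductor_submod.
apply: conductor_mulI => //; first exact: Theta_loc.
by apply: MN => //; apply: mulI_incl.
Qed.

Lemma local_eq M N : submod D M -> submod D N ->
  (forall T : overring D, Theta T -> mulI M T = mulI N T) -> M = N.
Proof.
by move=> sM sN e; apply/seteqP; split; apply: local_subset => // T /e ->.
Qed.

End LocalGlobal.

(** * Extension to an algebra *)

Section Extension.
Variables (F : fieldType) (D R : subring F).
Hypothesis sDR : D `<=` R.
(* This is all that is used of the retraction [R -> D]. *)
Hypothesis contract_ext : forall M : set F, submod D M -> M `<=` qf D ->
  mulI M R `&` qf D `<=` M.
Hypothesis ppRD : pseudo_polynomial R D.

Lemma contract_extE (M : set F) : submod D M -> M `<=` qf D ->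
  mulI M R `&` qf D = M.
Proof.
move=> sM MK; apply/seteqP; split; first exact: contract_ext.
by move=> x Mx; split; [apply: mulI_incl|apply: MK].
Qed.

Lemma contractR : R `&` qf D = D.
Proof.
by rewrite -[RHS](contract_extE (submod_sr D) (@qf_sub _ D)) (ext_one sDR).
Qed.

(** Pseudo-polynomiality gives I R = x R with x in the quotient field K of [D]; intersecting both
    sides with K returns I = x D. *)
Lemma ext_Princ_inj (I : InvI D) : Princ R (ext sDR I) -> Princ D I.
Proof.
move=> /(Invu_principal sDR ppRD (ext_Invu sDR I))[x [qx x0 eI]].
have [[Iq sI _] _] := invP I.
exists x; split=> //.
rewrite -(contract_extE sI Iq) -[mulI I R]/(ext sDR I : set F) eI -(ext_prin x sDR).
by apply: contract_extE; [apply: prin_submod|case: (prin_frac qx)].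
Qed.

(** * Extension to a single overring *)

Section OneOverring.
Variable T : overring D.
Local Notation RT := (compositum R T).

Lemma qf_overring : qf T = qf D.
Proof. exact: qf_idem (@orl _ _ T) (@orr _ _ T). Qed.

Lemma overring_submod (M : set F) : submod T M -> submod D M.
Proof. exact/submod_sub/orl. Qed.

Lemma mulI_qf_overring : mulI (qf D) T = qf D.
Proof. by apply: mulI1; rewrite -qf_overring; apply: qf_submod. Qed.

Lemma mulI_compositumR (M : set F) : submod R M -> mulI M RT = mulI M T.
Proof. by move=> sM; rewrite /= mulIA (mulI1 sM). Qed.

Lemma mulI_compositumT (M : set F) : submod T M -> mulI M RT = mulI M R.
Proof. by move=> sM; rewrite /= [mulI R T]mulIC mulIA (mulI1 sM). Qed.

Lemma compositum_denom x : RT x -> exists d, [/\ D d, d != 0 & R (d * x)].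
Proof.
move: x; apply: mulI_ind.
- by exists 1; rewrite oner_eq0 mulr0; split=> //; [apply: sr1|apply: sr0].
- move=> x y [a [Da a0 Rx]] [b [Db b0 Ry]]; exists (a * b).
  split; [exact: srM|exact: mulf_neq0|].
  by rewrite mulrDr; apply: srD; [rewrite mulrAC mulrC|rewrite -mulrA];
    apply: srM => //; apply: sDR.
move=> x y Rx /orr[a [b [Da Db b0 ->]]]; exists b; split=> //.
by rewrite mulrCA [b * _]mulrC divfK//; apply: srM => //; apply: sDR.
Qed.

(** A denominator d from [D] brings b into [R], where d b R = a R for some a in [D]; then b RT = (a
    / d) RT. *)
Lemma pseudo_polynomial_compositum : pseudo_polynomial RT T.
Proof.
move=> b RTb /(unitary_ex (I := prin RT b)).
case; first by exists 0; rewrite ?mulr0//; apply: sr0.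
move=> _ [[s RTs <-] qbs bs0]; rewrite qf_overring in qbs.
have [d [Dd d0 Rdb]] := compositum_denom RTb.
have [d' [Dd' d'0 Rds]] := compositum_denom RTs.
have [||a Da ea] := ppRD (b := d * b) => //.
  (* b s is the given nonzero element in the quotient field of [D]; the factors d and d' bring it
     into d b R. *)
  apply: (unitaryP (x := (d * b) * (d' * s))); first by exists (d' * s).
    by rewrite mulrACA; apply: qf_M => //; apply/qf_sub/srM.
  by rewrite mulrACA; apply: mulf_neq0 => //; apply: mulf_neq0.
have sRRT : R `<=` RT := @compositum_subl _ R T.
have eb : prin RT b = prin RT (a / d).
  rewrite -[b](mulKf d0) -(prin_mul _ d^-1) -(ext_prin (d * b) sRRT) ea ext_prin//.
  by rewrite prin_mul mulrC.
exists (a / d) => //.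
(* a / d lies in RT and in the quotient field of [D], and contraction of the [D]-module [T] puts it
   in [T]. *)
apply: contract_ext; [exact/overring_submod/submod_sr|exact: orr|split].
  rewrite mulIC; have : prin RT b (a / d) by rewrite eb; apply: prin_self.
  by case=> s' RTs' <-; apply: (@srM _ RT).
by apply: qf_M; [|apply: qf_V]; apply: qf_sub.
Qed.

Hypothesis Tloc : locally_trivial D T.

(** With K the quotient field of [D]: (I ∩ K) T = I T ∩ K = J R ∩ K = J. *)
Lemma contract_local (I : InvI R) (J : InvI T) :
  ext (@compositum_subl _ R T) I = ext (@compositum_subr _ R T) J ->
  mulI (I `&` qf D) T = J.
Proof.
move=> /(congr1 (@ival _ _)) /= eIJ.
have [[Jq sJ _] _] := invP J; rewrite qf_overring in Jq.
rewrite (mulI_setI Tloc); [|exact/(submod_sub sDR)/Inv_submod|exact: qf_submod].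
rewrite mulI_qf_overring.
move: eIJ; rewrite (mulI_compositumR (Inv_submod I)) mulI_compositumT// => ->.
exact/contract_extE/Jq/overring_submod.
Qed.

End OneOverring.

(** * Descent of ideals that locally come from the overrings *)

Variable Theta : set (overring D).
Hypothesis Theta_loc : forall T : overring D, Theta T -> locally_trivial D T.
Hypothesis Theta_complete : forall I, ideal D I ->
  I = \bigcap_(T in Theta) mulI I T.

Lemma contract_submod (I : InvI R) : submod D (I `&` qf D).
Proof.
by apply: submodI; [apply/(submod_sub sDR)/Inv_submod|apply: qf_submod].
Qed.

Lemma contract_frac (I : InvI R) : Invu R D I -> frac_ideal D (I `&` qf D).
Proof.
move=> /(Invu_pinched sDR)[a [b [Da a0 Db b0 [Ib aI]]]].
split; [by move=> x []|exact: contract_submod|exists a; split=> // x [Ix qx]].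
by rewrite -contractR; split; [apply: aI|apply: qf_M => //; apply: qf_sub].
Qed.

(** The equalities (I ∩ K)(I^-1 ∩ K) = D and I = (I ∩ K) R are checked after extension to each T,
    where [contract_local] turns them into J J^-1 = T and I T = J R. *)
Lemma descend (I : InvI R) : Invu R D I ->
  (forall T : overring D, Theta T -> exists J : InvI T,
    ext (@compositum_subl _ R T) I = ext (@compositum_subr _ R T) J) ->
  exists2 I0 : InvI D, I = ext sDR I0 & I0 = I `&` qf D :> set F.
Proof.
move=> uI eI.
have uNI : Invu R D (- I) by rewrite -sub0r; apply: sgB => //; apply: sg0.
have inv0I : invertible D (I `&` qf D).
  split; first exact: contract_frac.
  exists ((- I : InvI R) `&` qf D); first exact: contract_frac.
  apply: (local_eq Theta_loc Theta_complete).
  - exact/mulI_submod/contract_submod.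
  - exact: submod_sr.
  move=> T TT; have [J eJ] := eI T TT.
  rewrite (ext_mul T) (contract_local (Theta_loc TT) eJ).
  have eNJ : ext (@compositum_subl _ R T) (- I) =
      ext (@compositum_subr _ R T) (- J) by rewrite !raddfN; apply: congr1.
  rewrite (contract_local (Theta_loc TT) eNJ).
  by rewrite -InvD subrr (ext_one (@orl _ _ T)).
exists (MkInv inv0I) => //; apply: Inv_eq => /=.
apply: (local_eq Theta_loc Theta_complete).
- exact/(submod_sub sDR)/Inv_submod.
- exact/mulI_submod/contract_submod.
move=> T TT; have [J eJ] := eI T TT.
rewrite mulIA_AC (contract_local (Theta_loc TT) eJ).
rewrite -(mulI_compositumR T (Inv_submod I)) -(mulI_compositumT (Inv_submod J)).
exact: (congr1 (@ival _ _) eJ).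
Qed.

(** * Lifting ideals from one member of the Jaffard family *)

Hypothesis Theta_indep : forall T T' : overring D,
  Theta T -> Theta T' -> T <> T' -> mulI T T' = qf D.
Hypothesis Theta_finite : forall x, D x -> x != 0 ->
  finite_set [set T : overring D | Theta T /\ ~ T x^-1].

Lemma compositum_submod (T : overring D) (M : set F) :
  submod (compositum R T) M -> [/\ submod R M, submod T M & submod D M].
Proof.
move=> sM; split; first exact/submod_sub/sM/compositum_subl.
  exact/submod_sub/sM/compositum_subr.
exact/(submod_sub sDR)/submod_sub/sM/compositum_subl.
Qed.

(** As M = M T, independence gives M T' = M K, and there the nonzero element e of M can be divided
    out. *)
Lemma compositum_sub_mulI (T T' : overring D) (M : set F) e :
  Theta T -> Theta T' -> T <> T' -> submod (compositum R T) M ->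
  D e -> e != 0 -> M e -> compositum R T' `<=` mulI M T'.
Proof.
move=> TT TT' neqT /compositum_submod[sRM sTM _] De e0 Me.
have [_ _ RM] := sRM.
apply: mulI_ind => [|x y|r t Rr Tt]; [exact: mulI0|exact: mulID|].
have -> : r * t = (r * e) * (e^-1 * t) by rewrite mulrA mulfK.
rewrite -[M](mulI1 sTM) -mulIA; apply: mulI_in; first by apply: (RM r e).
rewrite (Theta_indep TT TT' neqT); apply: qf_M; last exact: (orr Tt).
exact/qf_V/qf_sub.
Qed.

(** The inverse of I is e^-1 P for an ideal P with P T = N and P T' = e RT' for the other T'. Then I
    P = e R holds locally: it reads J N = e RT over T, and RT' e RT' = e RT' elsewhere. *)
Lemma lift_inverse (T : overring D) (J N : set F) e :
  Theta T -> D e -> e != 0 ->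
  submod (compositum R T) J -> J `<=` compositum R T -> J e ->
  submod (compositum R T) N -> N `<=` compositum R T -> N e ->
  mulI J N = prin (compositum R T) e ->
  let I := J `&` R in
  [/\ invertible R I, mulI I T = J &
    forall T' : overring D, Theta T' -> T' <> T -> mulI I T' = compositum R T'].
Proof.
move=> TT De e0 sJ JRT Je sN NRT Ne JN I.
have Re := sDR De.
have [_ sTJ sDJ] := compositum_submod sJ.
have [_ sTN sDN] := compositum_submod sN.
have sDR' : submod D R by apply/(submod_sub sDR)/submod_sr.
have IT : mulI I T = J.
  rewrite (mulI_setI (Theta_loc TT))// (mulI1 sTJ).
  by apply/setIidPl.
have IT' (T' : overring D) : Theta T' -> T' <> T -> mulI I T' = compositum R T'.
  move=> TT' neqT; rewrite (mulI_setI (Theta_loc TT'))//.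
  by apply/setIidPr/(compositum_sub_mulI TT TT' _ sJ De e0 Je) => /esym.
(* Where e is a unit of T', the ideal e RT' is all of RT' and imposes nothing. The remaining T' are
   finitely many, so extension commutes with the intersection defining [P]. *)
pose S := [set T' : overring D | (Theta T' /\ ~ T' e^-1) /\ T' <> T].
have finS : finite_set S.
  by apply: sub_finite_set (Theta_finite De e0) => T' [].
pose P := (N `&` R) `&` \bigcap_(T' in S) prin (compositum R T') e.
have sDprin (T' : overring D) : submod D (prin (compositum R T') e).
  by have [] := compositum_submod (prin_submod (compositum R T') e).
have sDNR : submod D (N `&` R) by apply: submodI.
have PE (T' : overring D) : Theta T' -> submod D P /\ mulI P T' =
    (mulI N T' `&` compositum R T')
    `&` \bigcap_(T'' in S) mulI (prin (compositum R T'') e) T'.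
  move=> TT'; rewrite -[X in _ `&` X `&` _]/(mulI R T').
  rewrite -(mulI_setI (Theta_loc TT'))//.
  exact: (mulI_bigcap (Theta_loc TT')).
(* By independence, each factor e RT' with T' in [S] extends over T to something containing RT, so
   only N remains. *)
have PT : mulI P T = N.
  rewrite (PE T TT).2 (mulI1 sTN); apply/seteqP; split=> [x [[]]//|x Nx].
  split; first by split=> //; apply: NRT.
  move=> T' [[TT' _] neqT].
  apply: (compositum_sub_mulI TT' TT neqT _ De e0) (NRT _ Nx).
    exact: prin_submod.
  exact: prin_self.
have PT' (T' : overring D) :
    Theta T' -> T' <> T -> mulI P T' = prin (compositum R T') e.
  move=> TT' neqT; rewrite (PE T' TT').2; apply/seteqP; split.
    move=> x [[_ RTx] Sx].
    (* Either e is a unit of T' and e RT' = RT', or T' belongs to [S] and its own factor gives the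
       bound. *)
    have [Te'|Te'] := pselect (T' e^-1).
      rewrite (prin_unit (A := compositum R T'))//.
        exact: compositum_subl.
      exact: compositum_subr.
    have [_ sT' _] := compositum_submod (prin_submod (compositum R T') e).
    by rewrite -(mulI1 sT'); apply: (Sx T' (conj (conj TT' Te') neqT)).
  move=> x ex; have RTx : compositum R T' x.
    case: ex => a RTa <-; apply: (@srM _ (compositum R T')) => //.
    exact: compositum_subl.
  split; first split=> //.
    by apply: (compositum_sub_mulI TT TT' _ sN De e0 Ne) => // /esym.
  move=> T'' [[TT'' _] _]; have [->|neqT''] := pselect (T'' = T').
    exact: mulI_incl.
  apply: (compositum_sub_mulI TT'' TT' neqT'' _ De e0) RTx.
    exact: prin_submod.
  exact: prin_self.
have IP : mulI I P = prin R e.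
  apply: (local_eq Theta_loc Theta_complete).
  - exact/mulI_submod/submodI.
  - exact/(submod_sub sDR)/prin_submod.
  move=> T' TT'; rewrite ext_mul.
  rewrite -(mulI_compositumR _ (prin_submod R e)).
  rewrite (ext_prin _ (@compositum_subl _ R T')).
  have [->|neqT] := pselect (T' = T); first by rewrite IT PT.
  by rewrite IT'// PT'// mul1I//; apply: prin_submod.
have RJ : submod R J by have [] := compositum_submod sJ.
have RN : submod R N by have [] := compositum_submod sN.
split=> //; apply: (@Inv_integral _ R I _ _ e P) => //.
- by apply: integral_frac; [apply/submodI/submod_sr|move=> x []].
- by move=> x [].
- exact: qf_sub.
apply: integral_frac; last by move=> x [[]].
have [P0 PD _] : submod D P by case: (PE T TT).
split=> // a x Ra [[Nx Rx] Sx]; split; first split.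
- by have [_ _ NM] := RN; apply: NM.
- exact: srM.
move=> T' /Sx; have [_ _ pM] := prin_submod (compositum R T') e.
by apply: pM; apply: compositum_subl.
Qed.

(** Up to a principal factor generated in the quotient field of T, J is an integral ideal [J1]
    containing a nonzero e of [D]; the lift is [J1] ∩ R. *)
Lemma lift_Invu (T : overring D) (J : InvI (compositum R T)) :
  Theta T -> Invu (compositum R T) T J ->
  exists I : InvI R,
    [/\ Invu R D I, Princ (compositum R T) (ext (@compositum_subl _ R T) I - J)
      & forall T' : overring D, Theta T' -> T' <> T ->
        ext (@compositum_subl _ R T') I = 0].
Proof.
move=> TT /(Invu_fraction (@compositum_subr _ R T))[a [J1 [qa [a0 [JRT uJ ->]]]]].
have sJ := Inv_submod J1.
have [x [Jx qx x0]] : exists x, [/\ J1 x, qf T x & x != 0].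
  by apply: unitary_ex => //; case: sJ.
move: qx; rewrite qf_overring => -[e [q [De Dq q0 xE]]].
have e0 : e != 0 by apply: contra x0; rewrite xE => /eqP ->; rewrite mul0r.
have Je : J1 e.
  have -> : e = q * x by rewrite xE mulrCA mulfV ?mulr1.
  by have [_ _ [_ _ DJ]] := compositum_submod sJ; apply: DJ.
have RTe : compositum R T e by apply/compositum_subl/sDR.
(* N = e J1^-1 is integral because e lies in [J1], and contains e because [J1] is integral: the
   complementary factor for [lift_inverse]. *)
pose N : InvI (compositum R T) := MkInv (prin_inv (qf_sub RTe) e0) - J1.
have JN : mulI J1 N = prin (compositum R T) e by rewrite -InvD addrC subrK.
have NRT : N `<=` compositum R T.
  apply: mulI_ind => [|y z|_ y [c RTc <-] [_ yJ]]; [exact: sr0|exact: srD|].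
  by rewrite mulrAC; apply: srM => //; rewrite mulrC; apply: yJ.
have Ne : N e.
  rewrite -[e]mulr1; apply: mulI_in; first exact: prin_self.
  split=> [|y /JRT]; first exact/qf_sub/sr1.
  by rewrite mul1r.
have [invI IT IT'] :=
  lift_inverse TT De e0 sJ JRT Je (Inv_submod N) NRT Ne JN.
have IE (T' : overring D) :
    ext (@compositum_subl _ R T') (MkInv invI) = mulI (J1 `&` R) T' :> set F.
  exact: mulI_compositumR (Inv_submod (MkInv invI)).
exists (MkInv invI); split.
- move=> H [_]; apply; split; first by move=> y [].
  apply: (unitaryP (x := e)) => //; last exact/qf_sub.
  by split=> //; apply: sDR.
- have -> : ext (@compositum_subl _ R T) (MkInv invI) = J1.
    by apply: Inv_eq; rewrite IE.
  rewrite opprD addrA subrr -[0](subrr 0).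
  apply: sgB; first by rewrite subrr; apply: sg0.
  exists a; split=> //; exact/(qf_mono (@compositum_subr _ R T)).
by move=> T' TT' neqT; apply: Inv_eq; rewrite IE IT'.
Qed.

(** * The localization map and local Picard groups *)

Local Notation RT T := (compositum R (orring (val T))).
Local Notation res T := (extuu (@orl _ _ (val T)) (@compositum_subl _ R (val T))).
Local Notation Pics := (dsum (fun T : set_type Theta => Picu (RT T) (val T))).

(** With b in I and a I inside [R], I RT = RT as soon as a b is a unit of T: a^-1 in T gives one
    inclusion, b^-1 the other. Local finiteness at a b concludes. *)
Lemma ext_trivial_ae (I : InvI R) : Invu R D I ->
  finite_set [set T : overring D | Theta T /\ ext (@compositum_subl _ R T) I <> 0].
Proof.
move=> /(Invu_pinched sDR)[a [b [Da a0 Db b0 [Ib aI]]]].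
apply: sub_finite_set (Theta_finite (srM Da Db) (mulf_neq0 a0 b0)) => T [TT extI].
split=> // Tab; apply: extI; apply: Inv_eq => /=.
have Ta : T a^-1.
  have -> : a^-1 = b * (a * b)^-1 by rewrite invfM mulrCA mulfV ?mulr1.
  by apply: srM => //; apply: orl.
have Tb : T b^-1.
  have -> : b^-1 = a * (a * b)^-1 by rewrite invfM mulVKf.
  by apply: srM => //; apply: orl.
have sI := Inv_submod I; have [_ _ IM] := sI.
rewrite (mulI_compositumR T sI); apply/seteqP; split.
  apply: mulI_ind => [|x y|x t Ix Tt]; [exact: mulI0|exact: mulID|].
  have -> : x * t = (a * x) * (a^-1 * t) by rewrite [a * x]mulrC -mulrA mulVKf.
  by apply: mulI_in; [apply: aI|apply: srM].
apply: mulI_ind => [|x y|r t Rr Tt]; [exact: mulI0|exact: mulID|].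
have -> : r * t = (r * b) * (b^-1 * t) by rewrite mulrA mulfK.
by apply: mulI_in; [apply: IM|apply: srM].
Qed.

Lemma set_type_in (T : set_type Theta) : Theta (val T).
Proof. exact/set_mem/valP. Qed.

Lemma localization_exists : exists piT : {additive Picu R D -> Pics},
  forall I (T : set_type Theta),
    piT (qcls (Princu R D) I) T = qcls (Princu (RT T) (val T)) (res T I).
Proof.
have f_ex (T : set_type Theta) : exists f : {additive Picu R D -> Picu (RT T) (val T)},
    forall I, f (qcls (Princu R D) I) = qcls (Princu (RT T) (val T)) (res T I).
  have [|f fE] := @additive_of _ _ (fun I => qcls (Princu (RT T) (val T)) (res T I)).
    move=> I J; rewrite -raddfB; congr qcls; apply: val_inj => /=.
    by rewrite !raddfB.
  have [|g gE] := @quotg_factor _ (Princu R D) _ f.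
    move=> I [x [qx x0 eI]]; rewrite fE; apply/qcls_eq0.
    exists x; split=> //; first exact: qf_mono (@compositum_subl _ R (val T)) _ qx.
    by rewrite /= eI (ext_prin _ (@compositum_subl _ R (val T))).
  by exists g => I; rewrite gE fE.
pose f T := projT1 (cid (f_ex T)).
have fE T : forall I,
    f T (qcls (Princu R D) I) = qcls (Princu (RT T) (val T)) (res T I).
  exact: projT2 (cid (f_ex T)).
have [x|g gE] := @dsum_lift _ _ _ f; last by exists g => I T; rewrite gE fE.
have [I <-] := qcls_surj x.
have := ext_trivial_ae (set_mem (sgvalP I)).
move=> /(@finite_preimage _ _ _ (val : set_type Theta -> overring D)).
move=> /(_ (in2W val_inj)); apply: sub_finite_set => T /= fI.
split; first exact: set_type_in.
move=> extI; move/eqP: fI; apply; rewrite fE; apply/qcls_eq0.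
suff : Princ (RT T) (ext (@compositum_subl _ R (val T)) (sgval I)) by [].
by rewrite extI; apply: sg0.
Qed.

Section Localization.
Variable piT : {additive Picu R D -> Pics}.
Hypothesis piTE : forall I (T : set_type Theta),
  piT (qcls (Princu R D) I) T = qcls (Princu (RT T) (val T)) (res T I).

Lemma localization_single (T : set_type Theta) (c : Picu (RT T) (val T)) :
  exists x, piT x T = c /\ forall T', T' <> T -> piT x T' = 0.
Proof.
have [J <-] := qcls_surj c.
have [I [uI IJ I0]] := lift_Invu (set_type_in T) (set_mem (sgvalP J)).
exists (qcls _ (Subg (mem_set uI))); split.
  by rewrite piTE; apply/qcls_eq.
move=> T' neqT; rewrite piTE; apply/qcls_eq0.
suff : Princ (RT T') (ext (@compositum_subl _ R (val T')) I) by [].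
rewrite I0; [exact: sg0|exact: set_type_in|by move=> /val_inj].
Qed.

Lemma localization_surj : range piT = setT.
Proof. exact: dsum_surj localization_single. Qed.

(** Pseudo-polynomiality of RT over T places a generator of I RT in the quotient field of T, so I RT
    comes from a principal ideal of T and [descend] applies. *)
Lemma localization_ker (I : subg (Invu R D)) : piT (qcls (Princu R D) I) = 0 ->
  exists2 I0 : InvI D, sgval I = ext sDR I0 &
    forall T : overring D, Theta T -> Princ T (ext (@orl _ _ T) I0).
Proof.
move=> piI.
have loc (T : overring D) : Theta T -> exists2 J : InvI T, Princ T J &
    ext (@compositum_subl _ R T) (sgval I) = ext (@compositum_subr _ R T) J.
  move=> TT; pose T' : set_type Theta := SigSub (mem_set TT).
  have := piTE I T'; rewrite piI => /esym/qcls_eq0.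
  move=> /(Invu_principal (@compositum_subr _ R T) (@pseudo_polynomial_compositum T)
    (set_mem (sgvalP (res T' I))))[x [qx x0 eI]].
  exists (MkInv (prin_inv qx x0)); first by exists x.
  by apply: Inv_eq; rewrite [LHS]eI /= (ext_prin _ (@compositum_subr _ R T)).
have [|I0 eI0 I0E] := descend (set_mem (sgvalP I)).
  by move=> T /loc[J _ eJ]; exists J.
exists I0 => // T TT; have [J PJ eJ] := loc T TT.
suff -> : ext (@orl _ _ T) I0 = J by [].
by apply: Inv_eq; rewrite /= I0E; exact: (contract_local (Theta_loc TT) eJ).
Qed.

(** First isomorphism theorem for the localization map followed by the quotient maps onto the local
    Picard groups. An ideal in the kernel comes from T over every RT, so it descends to [D]. *)
Lemma LPicu_isog : isog (LPicu sDR)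
  (dsum (fun T : set_type Theta => LPicu (@compositum_subr _ R (val T)))).
Proof.
pose q (T : set_type Theta) := qcls (Pic_image (@compositum_subr _ R (val T))).
have f_ex (T : set_type Theta) :
    exists f : {additive Picu R D -> LPicu (@compositum_subr _ R (val T))},
      forall x, f x = q T (piT x T).
  apply: additive_of => x y; rewrite /q raddfB.
  exact: (raddfB (qcls _) (piT x T) (piT y T)).
pose f T := projT1 (cid (f_ex T)).
have fE T : forall x, f T x = q T (piT x T) := projT2 (cid (f_ex T)).
have [x|rho rhoE] := @dsum_lift _ _ _ f.
  apply: sub_finite_set (dsvalP (piT x)) => T; rewrite /= fE.
  by apply: contra => /eqP ->; rewrite /q raddf0.
apply: (first_isog (f := rho)).
  apply: dsum_surj => T c; have [c' <-] := qcls_surj c.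
  have [x [xT xT']] := localization_single c'.
  exists x; split=> [|T' /xT' x0]; first by rewrite rhoE fE xT.
  by rewrite rhoE fE x0 /q raddf0.
move=> x; split=> [rho0|[J _ <-]]; last first.
  apply: dsum_eq => T; rewrite rhoE fE /= piTE; apply/qcls_eq0.
  exists (ext (@orl _ _ (val T)) J) => //=; congr qcls; apply: val_inj.
  apply: Inv_eq; rewrite /= -!mulIA (ext_one (@compositum_subl _ R (val T))).
  by rewrite (ext_one (@compositum_subr _ R (val T))).
have [I IE] := qcls_surj x; rewrite -IE in rho0 *.
have loc (T : overring D) : Theta T -> exists J : InvI T,
    ext (@compositum_subl _ R T) (sgval I) = ext (@compositum_subr _ R T) J.
  move=> TT; pose T' : set_type Theta := SigSub (mem_set TT).
  have /qcls_eq0[J _] : q T' (piT (qcls (Princu R D) I) T') = 0.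
    by rewrite -fE -rhoE rho0.
  rewrite piTE /= => /esym/qcls_eq H.
  (* I RT and J RT differ by a principal factor; its generator can be taken in the quotient field of
     T and is absorbed into J. *)
  have := Invu_principal (@compositum_subr _ R T) (@pseudo_polynomial_compositum T)
    (set_mem (sgvalP (res T' I - extu (@compositum_subr _ R T) J))) H.
  move=> [y [qy y0 eI]]; exists (J + MkInv (prin_inv qy y0)).
  rewrite raddfD -[LHS](subrK (ext (@compositum_subr _ R T) J)) addrC; congr (_ + _).
  by apply: Inv_eq; rewrite [LHS]eI /= (ext_prin _ (@compositum_subr _ R T)).
have [I0 eI0 _] := descend (set_mem (sgvalP I)) loc.
by exists I0 => //=; congr qcls; apply: val_inj.
Qed.

End Localization.

End Extension.

(** * Flatness and retractions in the fraction field of R *)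

Section TwoGenerators.
Variables (D : comNzRingType) (a b : D).

(** The ideal (a, b), to be made an [lmodType] so that its inclusion in [D^o] can be tested against
    [flat]. *)
Definition two_gen : {pred D^o} := [in [set n : D | exists x y, n = x * a + y * b]].

Lemma two_gen_closed : subsemimod_closed two_gen.
Proof.
split; first split; first by apply/mem_set; exists 0, 0; rewrite !mul0r addr0.
  move=> _ _ /set_mem[x [y ->]] /set_mem[x' [y' ->]]; apply/mem_set.
  by exists (x + x'), (y + y'); rewrite !mulrDl addrACA.
move=> c _ /set_mem[x [y ->]]; apply/mem_set; exists (c * x), (c * y).
by rewrite -!mulrA -mulrDr.
Qed.

HB.instance Definition _ := GRing.isSubmodClosed.Build D D^o two_gen two_gen_closed.

Record two_gen_ideal := TwoGen { tg_val : D^o; tg_valP : two_gen tg_val }.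
HB.instance Definition _ := [isSub for tg_val].
HB.instance Definition _ := [Choice of two_gen_ideal by <:].
HB.instance Definition _ := [SubChoice_isSubLmodule of two_gen_ideal by <:].

End TwoGenerators.

Section Concrete.
Variables (D R : idomainType) (phi : {rmorphism D -> R}).
Local Notation L := {fraction R}.
Local Notation K := (qf (Dsub phi)).

HB.instance Definition _ := GRing.RMorphism.copy (@algR R) (@tofrac R).
HB.instance Definition _ := GRing.RMorphism.copy (algD phi) (@tofrac R \o phi).

Lemma retract_contract : retract phi ->
  forall M : set L, submod (Dsub phi) M -> M `<=` K -> mulI M (Rsub R) `&` K `<=` M.
Proof.
move=> [eps phiK] M [M0 MD MM] MK.
have algR_inj : injective (@algR R) by move=> x y /eqP; rewrite tofrac_eq => /eqP.
have algRM x y : algR (x * y) = algR x * algR y by apply: rmorphM.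
have phi_inj := can_inj phiK.
have algD_neq0 d : d != 0 -> algD phi d != 0.
  by rewrite /algD tofrac_eq0 -(inj_eq phi_inj) rmorph0.
(* [eps] extends to a map from [M R] to [M]; here is its graph. *)
pose Z : set L := [set x | exists y d r,
  [/\ M y, d != 0, algD phi d * x = algR r & algD phi d * y = algD phi (eps r)]].
have MRZ : mulI M (Rsub R) `<=` Z.
  apply: mulI_ind.
  - by exists 0, 1, 0; rewrite oner_eq0 !mulr0 !rmorph0.
  - move=> x x' [y [d [r [My d0 xE yE]]]] [y' [d' [r' [My' d'0 xE' yE']]]].
    exists (y + y'), (d * d'), (phi d' * r + phi d * r').
    split; [exact: MD|exact: mulf_neq0|..].
      rewrite rmorphM mulrDr mulrAC xE -mulrA xE' rmorphD !rmorphM.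
      by rewrite [algR r * _]mulrC.
    rewrite rmorphM mulrDr mulrAC yE -mulrA yE' !(rmorphD, rmorphM) !phiK.
    by rewrite [algD phi (eps r) * _]mulrC.
  move=> m _ Mm [r _ <-]; have [_ [_ [[p _ <-] [q _ <-] q0 mE]]] := MK m Mm.
  have qE : algD phi q * m = algD phi p by rewrite mE mulrCA mulfV ?mulr1.
  exists (m * algD phi (eps r)), q, (phi p * r); split.
  - by rewrite mulrC; apply: MM => //; exists (eps r).
  - by apply: contra q0 => /eqP ->; rewrite rmorph0.
  - by rewrite mulrA qE rmorphM.
  by rewrite mulrA qE !rmorphM phiK.
move=> x [/MRZ[y [d [r [My d0 xE yE]]]] [_ [_ [[p _ <-] [q _ <-] q0 xpq]]]].
suff -> : x = y by [].
apply: (mulfI (algD_neq0 _ d0)); rewrite yE; apply: (mulfI q0).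
(* The graph is the identity over K: clearing denominators in x = p / q and applying [eps] forces x
   = y. *)
have e : d * p = q * eps r.
  have /(congr1 eps) : phi (d * p) = phi q * r.
    apply: algR_inj; rewrite algRM -xE xpq -[LHS]/(algD phi (d * p)).
    by rewrite rmorphM -[algR (phi q)]/(algD phi q) mulrCA [algD phi q * _]mulrC divfK.
  by rewrite phiK [RHS]rmorphM phiK.
rewrite -rmorphM -e rmorphM xpq mulrCA; congr (_ * _).
by rewrite mulrCA mulfV ?mulr1.
Qed.

Lemma flat_locally_trivial (T : overring (Dsub phi)) :
  flat_sub phi T -> locally_trivial (Dsub phi) T.
Proof.
move=> [M [j [j_inj jT jZ Mflat]]] t Tt.
have [_ [_ [[a _ <-] [b _ <-] b0 tE]]] := orr Tt.
set c := conductor (Dsub phi) (Dsub phi) t.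
have csub : submod (Dsub phi) c by apply/conductor_submod/submod_sr.
have [c0 cD cM] := csub.
have cN x : c x -> c (- x).
  by move=> cx; rewrite -mulN1r; apply: cM => //; apply/srN/sr1.
(* d a = y b means d t = y, with y in [D]. Hence the coefficient of a in an element of (a, b) is
   determined modulo c, and a choice of coefficients is linear modulo c. *)
have c_in d y : d * a = y * b -> c (algD phi d).
  move=> e; split; first by exists d.
  exists y => //; apply: (mulIf b0).
  by rewrite -rmorphM -e rmorphM tE mulrA divfK.
(* Flatness, applied to N = (a, b) included in D, turns a = b t into the identity
   a (x) 1 = b (x) t in the tensor product of N and T; the latter is mapped to
   T / cT by the linear map f : x a + y b |-> x from N to D / c. *)
pose N := two_gen_ideal a b.
have /choice[f fE] : forall n : N, exists x : D, exists y, val n = x * a + y * b.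
  by move=> n; have /set_mem[x [y e]] := tg_valP n; exists x, y.
have fD n n' : c (algD phi (f (n + n')) - (algD phi (f n) + algD phi (f n'))).
  have [[y e] [[y' e'] [y'' e'']]] := (fE n, (fE n', fE (n + n'))).
  rewrite -rmorphD -rmorphB; apply: (c_in _ (y + y' - y'')).
  have {}e'' : f n * a + y * b + (f n' * a + y' * b) = f (n + n') * a + y'' * b :> D.
    by rewrite -e'' -e -e'.
  rewrite !mulrBl !mulrDl; apply/eqP; rewrite subr_eq; apply/eqP.
  have -> : f (n + n') * a = f n * a + y * b + (f n' * a + y' * b) - y'' * b.
    by rewrite e'' addrK.
  by rewrite addrACA [RHS]addrC [RHS]addrA.
have fZ d n : c (algD phi (f (d *: n)) - algD phi d * algD phi (f n)).
  have [[y e] [y'' e'']] := (fE n, fE (d *: n)).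
  rewrite -rmorphM -rmorphB; apply: (c_in _ (d * y - y'')).
  have {}e'' : d * (f n * a + y * b) = f (d *: n) * a + y'' * b :> D.
    by rewrite -e'' -e.
  rewrite !mulrBl; apply/eqP; rewrite subr_eq; apply/eqP.
  have -> : f (d *: n) * a = d * (f n * a + y * b) - y'' * b by rewrite e'' addrK.
  by rewrite mulrDr !mulrA [RHS]addrC [RHS]addrA.
have f0 : c (algD phi (f 0)).
  by have := fZ 0 0; rewrite scale0r rmorph0 mul0r subr0.
pose cT := mulI c T.
have cTB x y : cT x -> cT y -> cT (x - y).
  have [_ _ cTM] := mulI_submod T csub => cx cy; apply: mulID => //.
  by rewrite -mulN1r; apply: cTM => //; apply/srN/sr1.
have cTD x y : cT x -> cT y -> cT (x + y) by apply: mulID.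
have jP m : T (j m) by rewrite -jT; exists m.
(* [E] computes the induced map on formal sums; [EP] checks that each tensor relation is respected
   modulo cT. *)
pose E (s : seq (N * M)) : L := \sum_(p <- s) algD phi (f p.1) * j p.2.
have EP s s' : tensor_eq s s' -> cT (E s - E s').
  elim=> {s s'} [s|s s' _ IH|s s' s'' _ IH _ IH'|s s' u u' _ IH _ IH'
    |s s'|y|x x' y|x y y'|d x y].
  - by rewrite subrr; apply: mulI0.
  - by rewrite -opprB -sub0r; apply: cTB => //; apply: mulI0.
  - by rewrite -(subrK (E s') (E s)) -addrA; apply: cTD.
  - by rewrite /E !big_cat opprD addrACA; apply: cTD.
  - by rewrite /E !big_cat /= [X in _ - X]addrC subrr; apply: mulI0.
  - by rewrite /E big_seq1 big_nil subr0; apply: mulI_in.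
  - rewrite /E big_seq1 big_cons big_seq1 /= -mulrDl -mulrBl.
    exact: mulI_in.
  - rewrite /E big_seq1 big_cons big_seq1 /= raddfD mulrDr subrr; exact: mulI0.
  - rewrite /E !big_seq1 /= jZ mulrA -mulrBl [_ * algD phi d]mulrC.
    exact: mulI_in.
have [m1 _ m1E] : range j 1 by rewrite jT; apply: sr1.
have [mt _ mtE] : range j t by rewrite jT.
have aP : two_gen a b a by apply/mem_set; exists 1, 0; rewrite mul1r mul0r addr0.
have bP : two_gen a b b by apply/mem_set; exists 0, 1; rewrite mul1r mul0r add0r.
pose na : N := TwoGen aP; pose nb : N := TwoGen bP.
(* Over [D^o] both tensors equal 1 ⊗ a = 1 ⊗ b t; flatness pulls the equality back to N. *)
have /EP : tensor_eq [:: (na, m1)] [:: (nb, mt)].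
  apply: (Mflat N D^o (val : {linear N -> D^o}) val_inj) => /=.
  have e : a *: m1 = b *: mt.
    by apply: j_inj; rewrite !jZ m1E mtE mulr1 tE mulrCA mulfV ?mulr1.
  have tensorZ (x : D) m : @tensor_eq D D^o M [:: (x, m)] [:: (1, x *: m)].
    by rewrite -{1}[x]mulr1; apply: (@tensor_Z D D^o M).
  apply: (@tensor_trans D D^o M _ _ _ (tensorZ a m1)); rewrite e.
  exact: (@tensor_sym D D^o M _ _ (tensorZ b mt)).
rewrite /E !big_seq1 /= m1E mtE mulr1 => H.
(* From a = 1 a + 0 b and b = 0 a + 1 b, f is congruent to 1 at a and to 0 at b modulo c; so the
   difference of the two images forces 1 into cT. *)
have ca : c (algD phi (f na) - 1).
  have [y e] := fE na; rewrite -[1](rmorph1 (algD phi)) -rmorphB.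
  apply: (c_in _ (- y)); rewrite mulrBl mul1r -[X in _ - X]/(val na) e.
  by rewrite opprD addrA subrr add0r mulNr.
have cb : c (algD phi (f nb)).
  have [y e] := fE nb; apply: (c_in _ (1 - y)).
  by rewrite mulrBl mul1r -[X in X - _]/(val nb) e addrK.
have -> : 1 = algD phi (f na) - algD phi (f nb) * t - (algD phi (f na) - 1)
    + algD phi (f nb) * t :> L.
  by rewrite addrAC subrK opprB addrC subrK.
apply: cTD; last exact: mulI_in.
apply: cTB => //; exact: mulI_incl.
Qed.

End Concrete.

(** * The exact sequence and the decomposition of the local Picard group *)

Theorem theorem7p4 (D R : idomainType) (phi : {rmorphism D -> R})
    (Theta : set (overring (Dsub phi)))
    (D_not_field : exists2 x : D, x != 0 & x \isn't a GRing.unit)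
    (R_retract : retract phi)
    (R_pseudo : pseudo_polynomial (Rsub R) (Dsub phi))
    (Theta_jaffard : jaffard Theta) :
  let RT (T : set_type Theta) := compositum (Rsub R) (orring (val T)) in
  (exists (alpha : {additive subg (PicTheta Theta) -> Picu (Rsub R) (Dsub phi)})
          (piT : {additive Picu (Rsub R) (Dsub phi) ->
                   dsum (fun T : set_type Theta =>
                     Picu (RT T) (orring (val T)))}),
     [/\ forall (I : InvI (Dsub phi)) (c : subg (PicTheta Theta)),
           sgval c = qcls (Princ (Dsub phi)) I ->
           alpha c = qcls (Princu (Rsub R) (Dsub phi)) (extu (@DsubR _ _ phi) I),
         forall (I : subg (Invu (Rsub R) (Dsub phi))) (T : set_type Theta),
           piT (qcls (Princu (Rsub R) (Dsub phi)) I) T =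
           qcls (Princu (RT T) (orring (val T)))
             (extuu (@orl _ _ (val T))
                (@compositum_subl _ (Rsub R) (orring (val T))) I)
       & short_exact alpha piT])
  /\ isog (LPicu (@DsubR _ _ phi))
       (dsum (fun T : set_type Theta =>
          LPicu (@compositum_subr _ (Rsub R) (orring (val T))))).
Proof.
move=> RT; pose sDR := @DsubR _ _ phi.
have contract := retract_contract R_retract.
have Tloc T : Theta T -> locally_trivial (Dsub phi) T.
  by move=> /(jaffard_flat Theta_jaffard)/flat_locally_trivial.
have [[Tcomplete Tindep] Tfin] := (jaffard_complete Theta_jaffard,
  jaffard_independent Theta_jaffard, jaffard_finite Theta_jaffard).
have [piT piTE] := localization_exists sDR Tfin.
split; last first.
  exact: (LPicu_isog sDR contract R_pseudo Tloc Tcomplete Tindep Tfin piTE).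
(* Extension of ideals is first defined on all of Pic(D), then restricted to [PicTheta]. *)
have [x|g gE] := @quotg_factor _ (Princ (Dsub phi)) _
  (@qcls _ (Princu (Rsub R) (Dsub phi)) \o extu sDR).
  move=> [y [qy y0 eI]]; apply/qcls_eq0; exists y; split=> //.
    exact: qf_mono sDR _ qy.
  by rewrite /= eI (ext_prin _ sDR).
have [|alpha alphaE] :=
    @additive_of (subg (PicTheta Theta)) _ (g \o @sgval _ (PicTheta Theta)).
  by move=> c d; rewrite /= !raddfB.
exists alpha, piT; split=> //.
  by move=> I c cI; rewrite alphaE /= cI gE.
split; last exact: (localization_surj sDR Tloc Tcomplete Tindep Tfin piTE).
  (* Injectivity already holds on Pic(D), by [ext_Princ_inj]. *)
  apply: raddf_inj => c; rewrite alphaE /=; have [I IE] := qcls_surj (sgval c).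
  rewrite -IE gE => /qcls_eq0 /(ext_Princ_inj contract R_pseudo)/qcls_eq0.
  by rewrite IE => c0; apply: val_inj.
apply/seteqP; split=> [_ [c _ <-]|x].
  (* Image inside kernel: I T = y T extends to I RT = y RT. *)
  have [I cI HI] := set_mem (sgvalP c).
  rewrite /= alphaE /= cI gE; apply: dsum_eq => T.
  rewrite piTE; apply/qcls_eq0.
  have [y [qy y0 eI]] := HI _ (set_type_in T).
  exists y; split=> //; first exact: qf_mono (@compositum_subr _ (Rsub R) (val T)) _ qy.
  rewrite -(ext_prin _ (@compositum_subr _ (Rsub R) (val T))) -eI /=.
  rewrite -!mulIA (ext_one (@compositum_subl _ (Rsub R) (val T))).
  by rewrite (ext_one (@compositum_subr _ (Rsub R) (val T))).
have [I <-] := qcls_surj x.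
(* Kernel inside image: a class killed by [piT] descends to an ideal of [D] that is principal over
   every T. *)
move=> /(localization_ker sDR contract R_pseudo Tloc Tcomplete piTE)[I0 II0 HI0].
have PI0 : PicTheta Theta (qcls (Princ (Dsub phi)) I0) by exists I0.
exists (Subg (mem_set PI0)) => //; rewrite alphaE /= gE /=.
by congr qcls; apply: val_inj.
Qed.
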